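(* Let $A$ and $B$ be two nontrivial groups, both of Class $\mathcal{C}$. Then the standard restricted wreath product $A \wr B$ is itself of Class $\mathcal{C}$ if and only if (i) $B$ has a solvable power problem, and (ii) either $A$ is abelian or $B$ has a solvable order problem.
   Context: A group is recursively presented if it has a presentation with finitely many generators and a recursively enumerable set of defining relators. It is of Class $\mathcal{C}$ if it is recursively presented and has a solvable conjugacy problem for a given such presentation (there is an algorithm deciding, for any two words in the generators, whether they represent conjugate elements). Group elements are given as words in the generators. The power problem in $B$ is solvable if there is an algorithm deciding, for any $x,y\in B$, whether there exists an integer $n$ with $y=x^n$. The order problem in $B$ is solvable if there is an algorithm deciding, for any $x\in B$, whether the order of $x$ is finite. Standard restricted wreath product: $A\wr B=\{(b,f) : b\in B,\ f\in A^{(B)}\}$, where $A^{(B)}$ is the group (under pointwise multiplication) of functions $f:B\to A$ with finite support $\sigma(f)=\{s\in B: f(s)\neq 1_A\}$. The group $B$ acts on itself by right multiplication, $f^{c}(s)=f(sc^{-1})$, and $(b,f)(c,g)=(bc,f^{c}g)$. It is generated by the elements $(b,1)$ with $b$ a generator of $B$ and $(1_B,a^{(1_B)})$ with $a$ a generator of $A$, where $a^{(s)}$ is the function taking the value $a$ at $s$ and $1_A$ elsewhere. *)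

(* Defs.v *)
From HB Require Import structures.
From mathcomp Require Import all_boot.
From mathcomp Require Import ssrint.
From mathcomp Require Import finmap.

Set Implicit Arguments.
Unset Strict Implicit.
Unset Printing Implicit Defensive.

Local Open Scope nat_scope.

(* The (total) recursive functions of several natural number arguments: the
   least class containing the initial functions and closed under composition,
   primitive recursion and minimization of regular functions. As functions are
   represented extensionally, rec_ext closes the class under pointwise
   equality. *)
Inductive recursive : forall n : nat, (n.-tuple nat -> nat) -> Prop :=
| rec_zero : recursive (fun _ : 0.-tuple nat => 0)
| rec_succ : recursive (fun v : 1.-tuple nat => (thead v).+1)
| rec_proj n (i : 'I_n) : recursive (fun v : n.-tuple nat => tnth v i)
| rec_comp m n (f : m.-tuple nat -> nat) (g : 'I_m -> n.-tuple nat -> nat) :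
    recursive f -> (forall i, recursive (g i)) ->
    recursive (fun v => f [tuple g i v | i < m])
| rec_prim n (f : n.-tuple nat -> nat) (g : n.+2.-tuple nat -> nat) :
    recursive f -> recursive g ->
    recursive (fun v : n.+1.-tuple nat =>
      iteri (thead v) (fun k r => g [tuple of k :: r :: [tuple of behead v]])
            (f [tuple of behead v]))
| rec_min n (g : n.+1.-tuple nat -> nat)
    (regular : forall v : n.-tuple nat, exists y, g [tuple of y :: v] == 0) :
    recursive g -> recursive (fun v => ex_minn (regular v))
| rec_ext n (f g : n.-tuple nat -> nat) :
    f =1 g -> recursive f -> recursive g.

Definition recursively_enumerable (S : nat -> Prop) : Prop :=
  (forall x, ~ S x) \/
  (exists2 f : 1.-tuple nat -> nat, recursive f &
     forall x, S x <-> exists k, f [tuple k] = x).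

(* The letter (i, false) stands for the i-th generator and (i, true) for its
   formal inverse. *)
Definition word (m : nat) : Type := seq ('I_m * bool).

Definition word_code (m : nat) (w : word m) : nat :=
  CodeSeq.code [seq (nat_of_ord l.1).*2 + l.2 | l : 'I_m * bool <- w].

Lemma word_code_inj m : injective (@word_code m).
Proof.
move=> u v /(can_inj CodeSeq.codeK); apply: inj_map => -[i b] [j c] /= e.
have bc : b = c by move/(congr1 odd): e; rewrite !oddD !odd_double !oddb.
by move: e; rewrite bc => /addIn/double_inj/val_inj ->.
Qed.

(* Algorithms are only required to be correct on codes of words. *)
Definition decidable_words1 (m : nat) (P : word m -> Prop) : Prop :=
  exists2 f : 1.-tuple nat -> nat, recursive f &
    forall u, P u <-> f [tuple word_code u] = 1.

Definition decidable_words2 (m : nat) (P : word m -> word m -> Prop) : Prop :=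
  exists2 f : 2.-tuple nat -> nat, recursive f &
    forall u v, P u v <-> f [tuple word_code u; word_code v] = 1.

Definition word_eval (G : groupType) (m : nat) (g : 'I_m -> G) (w : word m) : G :=
  (\prod_(l <- w) (if l.2 then (g l.1)^-1 else g l.1))%g.

(* Equality in the group < x_0, ..., x_(m-1) | R >, whose elements are the
   classes of words modulo this congruence. *)
Inductive presented_eq (m : nat) (R : word m -> Prop) : word m -> word m -> Prop :=
| presented_refl u : presented_eq R u u
| presented_sym u v : presented_eq R u v -> presented_eq R v u
| presented_trans u v w :
    presented_eq R u v -> presented_eq R v w -> presented_eq R u w
| presented_cancel u v i b :
    presented_eq R (u ++ [:: (i, b); (i, ~~ b)] ++ v) (u ++ v)
| presented_relator u v r : R r -> presented_eq R (u ++ r ++ v) (u ++ v).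

Record recursive_presentation (G : groupType) : Type := RecursivePresentation {
  generator_count : nat;
  gens : 'I_generator_count -> G;
  relators : word generator_count -> Prop;
  gens_generate : forall x : G, exists w, word_eval gens w = x;
  relators_define : forall u v,
    word_eval gens u = word_eval gens v <-> presented_eq relators u v;
  relators_re :
    recursively_enumerable (fun x => exists2 r, relators r & word_code r = x)
}.

Definition zexpg (G : groupType) (x : G) (n : int) : G :=
  match n with Posz k => (x ^+ k)%g | Negz k => (x ^- k.+1)%g end.

Definition finite_order (G : groupType) (x : G) : Prop :=
  exists2 n, 0 < n & (x ^+ n = 1)%g.

Section Problems.
Variables (G : groupType) (P : recursive_presentation G).
Local Notation eval := (word_eval (@gens G P)).

Definition solvable_conjugacy_problem : Prop :=
  decidable_words2 (fun u v => exists z : G, (eval v = eval u ^ z)%g).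

Definition solvable_power_problem : Prop :=
  decidable_words2 (fun u v => exists n : int, eval v = zexpg (eval u) n).

Definition solvable_order_problem : Prop :=
  decidable_words1 (fun u => finite_order (eval u)).

End Problems.

Definition class_C (G : groupType) : Prop :=
  exists P : recursive_presentation G, solvable_conjugacy_problem P.

Definition is_abelian (G : groupType) : Prop := forall x y : G, commute x y.

Definition nontrivial (G : groupType) : Prop := exists x : G, x <> 1%g.

Record wreath (A B : groupType) : Type := Wreath {
  wreath_base : B;
  wreath_fun : {fsfun B -> A with 1%g}
}.

Section WreathGroup.
Variables A B : groupType.
Local Open Scope fset_scope.
Local Notation afun := {fsfun B -> A with 1%g}.

Definition wreath_pair (x : wreath A B) : B * afun :=
  (wreath_base x, wreath_fun x).
Definition pair_wreath (p : B * afun) : wreath A B := Wreath p.1 p.2.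
Lemma wreath_pairK : cancel wreath_pair pair_wreath. Proof. by case. Qed.

HB.instance Definition _ := Choice.copy (wreath A B) (can_type wreath_pairK).

Definition fun_one : afun := [fsfun with 1%g].

Definition fun_mul (f g : afun) : afun :=
  [fsfun s in finsupp f `|` finsupp g => (f s * g s)%g].

Definition fun_inv (f : afun) : afun :=
  [fsfun s in finsupp f => (f s)^-1%g].

Definition fun_act (f : afun) (c : B) : afun :=
  [fsfun s in [fset (t * c)%g | t in finsupp f] => f (s * c^-1)%g].

Lemma fun_mulE f g s : fun_mul f g s = (f s * g s)%g.
Proof.
rewrite fsfunE inE; case: ifP => // /negbT; rewrite negb_or => /andP[fs gs].
by rewrite !fsfun_dflt // mulg1.
Qed.

Lemma fun_invE f s : fun_inv f s = (f s)^-1%g.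
Proof. by rewrite fsfunE; case: finsuppP => //; rewrite invg1. Qed.

Lemma fun_actE f c s : fun_act f c s = f (s * c^-1)%g.
Proof.
rewrite fsfunE; case: ifP => // /negbT nin; rewrite fsfun_dflt //.
apply: contra nin => fs; apply/imfsetP; exists (s * c^-1)%g => //.
by rewrite mulgVK.
Qed.

Definition wreath_mul (x y : wreath A B) : wreath A B :=
  Wreath (wreath_base x * wreath_base y)%g
         (fun_mul (fun_act (wreath_fun x) (wreath_base y)) (wreath_fun y)).

Definition wreath_one : wreath A B := Wreath 1%g fun_one.

Definition wreath_inv (x : wreath A B) : wreath A B :=
  Wreath (wreath_base x)^-1%g
         (fun_act (fun_inv (wreath_fun x)) (wreath_base x)^-1%g).

Lemma wreathP (x y : wreath A B) :
  wreath_base x = wreath_base y -> wreath_fun x =1 wreath_fun y -> x = y.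
Proof. by case: x y => [b f] [c g] /= -> /fsfunP ->. Qed.

Lemma wreath_mulA : associative wreath_mul.
Proof.
move=> x y z; apply: wreathP => [|s] /=; first by rewrite mulgA.
by rewrite !(fun_mulE, fun_actE) invgM !mulgA.
Qed.

Lemma wreath_mul1g : left_id wreath_one wreath_mul.
Proof.
move=> x; apply: wreathP => [|s] /=; first by rewrite mul1g.
by rewrite !(fun_mulE, fun_actE) fsfun0E mul1g.
Qed.

Lemma wreath_mulg1 : right_id wreath_one wreath_mul.
Proof.
move=> x; apply: wreathP => [|s] /=; first by rewrite mulg1.
by rewrite !(fun_mulE, fun_actE) fsfun0E invg1 !mulg1.
Qed.

Lemma wreath_mulVg : left_inverse wreath_one wreath_inv wreath_mul.
Proof.
move=> x; apply: wreathP => [|s] /=; first by rewrite mulVg.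
by rewrite !(fun_mulE, fun_actE, fun_invE) fsfun0E invgK mulgVK mulVg.
Qed.

Lemma wreath_mulgV : right_inverse wreath_one wreath_inv wreath_mul.
Proof.
move=> x; apply: wreathP => [|s] /=; first by rewrite mulgV.
by rewrite !(fun_mulE, fun_actE, fun_invE) fsfun0E mulgV.
Qed.

HB.instance Definition _ := isGroup.Build (wreath A B)
  wreath_mulA wreath_mul1g wreath_mulg1 wreath_mulVg wreath_mulgV.

End WreathGroup.

(* Main.v *)
(* Conjugating (b, f) by (d, h) turns b into c = b^d and f into a function g
   with f(s d^-1) h(s) = h(s c^-1) g(s), i.e. f^d and g are cohomologous over the
   translation by c. On a coset r<c> this telescopes: if c has infinite order,
   the ordered products of f^d and g over the coset must agree, and if c has
   finite order they must be conjugate in A; conversely the partial products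
   provide h. If f^d is not cohomologous to 1, some supp(f) d <c> meets
   supp(g) <c>, and multiplying d by a power of c puts it into the finite set
   supp(f)^-1 supp(g). So with the power problem (coset membership) and the order
   problem (which of the two criteria applies; for abelian A they coincide),
   conjugacy is decided by finitely many comparisons. In the other direction,
   for a <> 1 the element x a^(1) (a^-1)^(y) is conjugate to x iff y lies in <x>,
   and for ab <> ba the element x (ab)^(1) is conjugate to x (ba)^(1) iff x has
   finite order. *)
Require Import Defs.
From mathcomp Require Import all_boot ssrint finmap boolp.

Set Implicit Arguments.
Unset Strict Implicit.
Unset Printing Implicit Defensive.

Local Open Scope nat_scope.

(** * Computable functions between coded types *)

(** [class_C] asks for some presentation. For sufficiency it is therefore enough to decide conjugacy
    for one generating family: the word problem is then decidable, since only 1 is conjugate to 1,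
    and the set of all trivial words, now recursively enumerable, serves as the set of relators. For
    necessity the given presentation of the wreath product is arbitrary, so words over the
    generators of [B] are first translated through a finite table of chosen words. Coset membership
    yields no exponents. The order of [c] and a bound on the exponents relating the listed points
    are found by unbounded search, which must succeed on every input; hence the search for the order
    first asks whether the order is finite. In the abelian case neither number is computed: the
    product over a coset is formed by testing each listed point for membership. When f^d is
    cohomologous to 1, so is g, and any other conjugator of the base parts would do as well as d;
    what is left is a conjugacy question in [B]. *)

Section RecursiveFunctions.
Variable n : nat.
Implicit Types f g h : n.-tuple nat -> nat.

Lemma recursive_apply1 (f : nat -> nat) g :
  recursive (fun v : 1.-tuple nat => f (thead v)) -> recursive g ->
  recursive (fun v => f (g v)).
Proof.
move=> rf rg; apply: rec_ext (rec_comp rf (fun=> rg)) => v /=.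
by rewrite /thead tnth_mktuple.
Qed.

Lemma recursive_succ g : recursive g -> recursive (fun v => (g v).+1).
Proof. exact: recursive_apply1 rec_succ. Qed.

Lemma recursive_const c : recursive (fun _ : n.-tuple nat => c).
Proof.
elim: c => [|c rc]; last exact: recursive_succ.
have rk (i : 'I_0) : recursive (fun _ : n.-tuple nat => 0) by case: i.
exact: rec_ext (rec_comp rec_zero rk).
Qed.

End RecursiveFunctions.

Lemma recursive_behead n (g : n.-tuple nat -> nat) :
  recursive g -> recursive (fun v : n.+1.-tuple nat => g [tuple of behead v]).
Proof.
move=> rg; apply: rec_ext (rec_comp rg (fun i => rec_proj (lift ord0 i))) => v.
congr g; apply: eq_from_tnth => i; rewrite tnth_mktuple tnth_behead.
by congr tnth; apply: val_inj => /=; rewrite inordK // ltnS.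
Qed.

(** [rec_prim] recurses on the first argument, so a recursion whose length is a function of the
    parameters needs this substitution for the head. *)
Lemma recursive_cons n (f : n.+1.-tuple nat -> nat) (g : n.-tuple nat -> nat) :
  recursive f -> recursive g -> recursive (fun v => f [tuple of g v :: v]).
Proof.
move=> rf rg.
pose k (i : 'I_n.+1) : n.-tuple nat -> nat :=
  if unlift ord0 i is Some j then (fun v => tnth v j) else g.
have rk i : recursive (k i).
  by rewrite /k; case: unliftP => [j _|_] //; exact: rec_proj.
apply: rec_ext (rec_comp rf rk) => v; congr f; apply: eq_from_tnth => i.
by rewrite tnth_mktuple /k; case: unliftP => [j ->|->]; rewrite ?tnthS ?tnth0.
Qed.

Section RecursionSchemes.
Variable n : nat.
Implicit Types f g h : n.-tuple nat -> nat.

Lemma recursive_iteri (step : nat -> nat -> n.-tuple nat -> nat) cnt init :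
  recursive (fun v : n.+2.-tuple nat => step (thead v)
    (thead [tuple of behead v]) [tuple of behead [tuple of behead v]]) ->
  recursive cnt -> recursive init ->
  recursive (fun v => iteri (cnt v) (fun k r => step k r v) (init v)).
Proof.
move=> rs rc ri; apply: rec_ext (recursive_cons (rec_prim ri rs) rc) => v /=.
rewrite (_ : init _ = init v); last first.
  by congr init; apply: val_inj.
rewrite {1}/thead tnth0; apply: eq_iteri => k r; rewrite /thead !tnth0.
by congr step; apply: val_inj.
Qed.

(** [rec_min] looks for a zero, so the hypothesis concerns the negation of [p], read as a 0/1-valued
    function. *)
Lemma recursive_search (p : nat -> n.-tuple nat -> bool)
    (regular : forall v, exists y, p y v) :
  recursive (fun v : n.+1.-tuple nat =>
    p (thead v) [tuple of behead v] == 0 :> nat) ->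
  recursive (fun v => ex_minn (regular v)).
Proof.
move=> rp.
have q (v : n.-tuple nat) y : ((p (thead [tuple of y :: v])
    [tuple of behead [tuple of y :: v]] == 0 :> nat) == 0 :> nat) = p y v.
  have -> : [tuple of behead [tuple of y :: v]] = v by exact: val_inj.
  by rewrite /thead tnth0; case: (p y v).
have reg (v : n.-tuple nat) : exists y, (p (thead [tuple of y :: v])
     [tuple of behead [tuple of y :: v]] == 0 :> nat) == 0 :> nat.
  by have [y pyv] := regular v; exists y; rewrite q.
apply: rec_ext (rec_min reg rp) => v.
by apply: eq_ex_minn => y; rewrite q.
Qed.

Lemma recursive_addn g h :
  recursive g -> recursive h -> recursive (fun v => g v + h v).
Proof.
move=> rg rh.
have r := @recursive_iteri (fun _ r _ => r.+1) g h _ rg rh.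
apply: rec_ext (r _) => [v|]; first by elim: (g v) => //= k ->.
by apply/recursive_succ/recursive_behead/rec_proj.
Qed.

Lemma recursive_eq0 g : recursive g -> recursive (fun v => g v == 0 :> nat).
Proof.
move=> rg; have r := @recursive_iteri (fun _ _ _ => 0) g (fun=> 1).
apply: rec_ext (r _ rg _) => [v||]; try exact: recursive_const.
by case: (g v).
Qed.

End RecursionSchemes.

Section RecursivePairing.
Variable n : nat.
Implicit Types f g h : n.-tuple nat -> nat.

Lemma recursive_pred g : recursive g -> recursive (fun v => (g v).-1).
Proof.
move=> rg; have r := @recursive_iteri n (fun k _ _ => k) g (fun=> 0).
apply: rec_ext (r _ rg _) => [v||]; last exact: recursive_const.
  by case: (g v).
exact: rec_proj.
Qed.

Lemma recursive_double g : recursive g -> recursive (fun v => (g v).*2).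
Proof.
by move=> rg; apply: rec_ext (recursive_addn rg rg) => v; rewrite addnn.
Qed.

Lemma recursive_odd g : recursive g -> recursive (fun v => odd (g v)).
Proof.
move=> rg; have r := @recursive_iteri n (fun _ r _ => r == 0) g (fun=> 0).
apply: rec_ext (r _ rg _) => [v||]; last exact: recursive_const.
  by elim: (g v) => //= k ->; case: odd.
exact/recursive_eq0/recursive_behead/rec_proj.
Qed.

End RecursivePairing.

Lemma recursive_half n (g : n.-tuple nat -> nat) :
  recursive g -> recursive (fun v => (g v)./2).
Proof.
move=> rg; have r := @recursive_iteri n (fun k r _ => odd k + r) g (fun=> 0).
apply: rec_ext (r _ rg _) => [v||]; last exact: recursive_const.
  by elim: (g v) => //= k ->; rewrite uphalf_half.
by apply: recursive_addn; [apply: recursive_odd|apply: recursive_behead];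
  exact: rec_proj.
Qed.

(** Iterated doubling makes recursiveness immediate. The bijection is chosen to fit [CodeSeq.code]:
    the code of a nonempty list is the successor of the pair code of its head and tail. *)
Definition pair_code (p : nat * nat) : nat :=
  (iteri p.1 (fun _ => double) p.2.*2.+1).-1.

Lemma pair_codeE p : pair_code p = (2 ^ p.1 * p.2.*2.+1).-1.
Proof.
rewrite /pair_code; congr _.-1; elim: p.1 => [|k /= ->]; first by rewrite mul1n.
by rewrite expnS -mulnA mul2n.
Qed.

Definition shiftr (n k : nat) : nat := iteri k (fun _ => half) n.

Lemma shiftr_double k j m :
  shiftr (2 ^ (k + j) * m) k = 2 ^ j * m.
Proof.
rewrite /shiftr; elim: k j => //= k IH j.
by rewrite addSnnS IH expnS -mulnA mul2n doubleK.
Qed.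

Lemma shiftr_odd_ex n : exists k, odd (shiftr n.+1 k).
Proof.
have : 0 < n.+1 by [].
move: n.+1 => m; elim/ltn_ind: m => m IH m0.
case om: (odd m); first by exists 0.
have m2 : m = m./2.*2 by rewrite -[LHS]odd_double_half om.
have half0 : 0 < m./2 by rewrite -double_gt0 -m2.
have [|k] := IH _ _ half0; first by rewrite [ltnRHS]m2 -addnn -ltn_subLR // subnn.
move=> ok; exists k.+1; congr odd: ok.
by elim: k => //= k ->.
Qed.

(** The 2-adic valuation of [n.+1], in a form that [rec_min] computes. *)
Definition pair_code1 (n : nat) : nat := ex_minn (shiftr_odd_ex n).
Definition pair_code2 (n : nat) : nat := (shiftr n.+1 (pair_code1 n))./2.
Definition pair_decode (n : nat) : nat * nat := (pair_code1 n, pair_code2 n).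

Lemma pair_codeK : cancel pair_code pair_decode.
Proof.
case=> x y; rewrite /pair_decode /pair_code2.
have -> : pair_code1 (pair_code (x, y)) = x.
  rewrite /pair_code1; case: ex_minnP => k; rewrite pair_codeE /=.
  rewrite prednK ?muln_gt0 ?expn_gt0 // => ok kmin; apply/eqP.
  rewrite eqn_leq kmin /=; last first.
    by rewrite -{1}[x]addn0 shiftr_double mul1n /= odd_double.
  rewrite leqNgt; apply/negP => kx; move: ok.
  by rewrite -(subnKC kx) addSnnS shiftr_double expnS -mulnA oddM.
rewrite pair_codeE /= prednK ?muln_gt0 ?expn_gt0 //.
by rewrite -{2}[x]addn0 shiftr_double mul1n /= uphalf_double.
Qed.

Lemma pair_decodeK : cancel pair_decode pair_code.
Proof.
move=> n; rewrite pair_codeE /= /pair_code2 /pair_code1.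
case: ex_minnP => k ok kmin.
(* The first [k] halvings are exact, because by minimality of [k] all earlier shifts are even. *)
suff e j : j <= k -> 2 ^ j * shiftr n.+1 j = n.+1.
  have := e k (leqnn k).
  by rewrite -[in X in X -> _](odd_double_half (shiftr n.+1 k)) ok add1n => ->.
elim: j => [|j IH] jk; first by rewrite mul1n.
rewrite -[RHS](IH (ltnW jk)) expnSr -mulnA /=; congr muln.
rewrite mul2n -[RHS]odd_double_half.
by case: (boolP (odd _)) => // /kmin; rewrite leqNgt jk.
Qed.

Lemma recursive_pair_code n (g h : n.-tuple nat -> nat) :
  recursive g -> recursive h -> recursive (fun v => pair_code (g v, h v)).
Proof.
move=> rg rh; apply/recursive_pred.
apply: (@recursive_iteri _ (fun _ r _ => r.*2)) => //.
  exact/recursive_double/recursive_behead/rec_proj.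
exact/recursive_succ/recursive_double.
Qed.

Lemma recursive_shiftr n (g h : n.-tuple nat -> nat) :
  recursive g -> recursive h -> recursive (fun v => shiftr (g v) (h v)).
Proof.
move=> rg rh; apply: (@recursive_iteri _ (fun _ r _ => r./2)) => //.
exact/recursive_half/recursive_behead/rec_proj.
Qed.

Lemma recursive_pair_code1 :
  recursive (fun v : 1.-tuple nat => pair_code1 (thead v)).
Proof.
apply: (@recursive_search 1 (fun y v => odd (shiftr (thead v).+1 y))
  (fun v => shiftr_odd_ex (thead v))).
apply/recursive_eq0/recursive_odd/recursive_shiftr; last exact: rec_proj.
exact/recursive_succ/recursive_behead/rec_proj.
Qed.

(* Bijections with [nat], so that every function between coded types is a total
   function on [nat], as minimization requires. *)
Class coded (T : Type) := Coded {
  enc : T -> nat;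
  dec : nat -> T;
  encK : cancel enc dec;
  decK : cancel dec enc
}.

#[export] Instance coded_nat : coded nat :=
  @Coded nat id id (fun=> erefl) (fun=> erefl).

Section CodedPairs.
Context {T U : Type} {cT : coded T} {cU : coded U}.

Definition prod_enc (p : T * U) : nat := pair_code (enc p.1, enc p.2).
Definition prod_dec (n : nat) : T * U :=
  (dec (pair_decode n).1, dec (pair_decode n).2).

Lemma prod_encK : cancel prod_enc prod_dec.
Proof. by case=> x y; rewrite /prod_dec /prod_enc pair_codeK /= !encK. Qed.

Lemma prod_decK : cancel prod_dec prod_enc.
Proof.
by move=> n; rewrite /prod_dec /prod_enc /= !decK; exact: pair_decodeK.
Qed.

#[export] Instance coded_prod : coded (T * U) := Coded prod_encK prod_decK.

End CodedPairs.

Section CodedSeqs.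
Context {T : Type} {cT : coded T}.

Definition seq_enc (s : seq T) : nat := CodeSeq.code (map enc s).
Definition seq_dec (n : nat) : seq T := map dec (CodeSeq.decode n).

Lemma seq_encK : cancel seq_enc seq_dec.
Proof. by move=> s; rewrite /seq_dec CodeSeq.codeK mapK //; exact: encK. Qed.

Lemma seq_decK : cancel seq_dec seq_enc.
Proof.
by move=> n; rewrite /seq_enc mapK ?CodeSeq.decodeK //; exact: decK.
Qed.

#[export] Instance coded_seq : coded (seq T) := Coded seq_encK seq_decK.

End CodedSeqs.

(** Several arguments are packed into nested pairs. Truth values enter as the numbers 0 and 1, as a
    coded type is in bijection with [nat]. *)
Definition computable {T U : Type} {cT : coded T} {cU : coded U}
    (f : T -> U) : Prop :=
  recursive (fun v : 1.-tuple nat => enc (f (dec (thead v)))).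

Section Computable.
Context {X T U : Type} {cX : coded X} {cT : coded T} {cU : coded U}.

Lemma computable_ext (f g : X -> T) : f =1 g -> computable f -> computable g.
Proof. by move=> fg; apply: rec_ext => v; rewrite fg. Qed.

Lemma computable_id : computable (fun x : X => x).
Proof. by apply: rec_ext (rec_proj ord0) => v; rewrite /= decK. Qed.

Lemma computable_const (c : T) : computable (fun _ : X => c).
Proof. exact: recursive_const. Qed.

Lemma computable_comp (f : T -> U) (g : X -> T) :
  computable f -> computable g -> computable (fun x => f (g x)).
Proof.
move=> cf cg; have rg := @recursive_apply1 1 (fun n => enc (f (dec n))) _ cf cg.
by apply: rec_ext rg => v; rewrite /= encK.
Qed.

Lemma computable_pair (f : X -> T) (g : X -> U) :
  computable f -> computable g -> computable (fun x => (f x, g x)).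
Proof. exact: recursive_pair_code. Qed.

End Computable.

Section ComputableOps.
Context {X T U : Type} {cX : coded X} {cT : coded T} {cU : coded U}.

Lemma computable_fst (f : X -> T * U) :
  computable f -> computable (fun x => (f x).1).
Proof.
apply: computable_comp.
by apply: rec_ext recursive_pair_code1 => v; rewrite /= decK.
Qed.

Lemma computable_snd (f : X -> T * U) :
  computable f -> computable (fun x => (f x).2).
Proof.
apply: computable_comp.
have: recursive (fun v : 1.-tuple nat => pair_code2 (thead v)).
  apply/recursive_half/recursive_shiftr/recursive_pair_code1.
  exact/recursive_succ/rec_proj.
by apply: rec_ext => v; rewrite /= decK.
Qed.

Lemma computable_enc (f : X -> T) : computable f -> computable (fun x => enc (f x)).
Proof. by []. Qed.

Lemma computable_dec (f : X -> nat) :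
  computable f -> computable (fun x => dec (f x) : T).
Proof. by apply: rec_ext => v; rewrite decK. Qed.

Lemma computable_succ (f : X -> nat) :
  computable f -> computable (fun x => (f x).+1).
Proof. exact: recursive_succ. Qed.

Lemma computable_pred (f : X -> nat) :
  computable f -> computable (fun x => (f x).-1).
Proof. exact: recursive_pred. Qed.

Lemma computable_odd (f : X -> nat) :
  computable f -> computable (fun x => odd (f x) : nat).
Proof. exact: recursive_odd. Qed.

Lemma computable_eq0 (f : X -> nat) :
  computable f -> computable (fun x => f x == 0 : nat).
Proof. exact: recursive_eq0. Qed.

Lemma computable_addn (f g : X -> nat) :
  computable f -> computable g -> computable (fun x => f x + g x).
Proof. exact: recursive_addn. Qed.

End ComputableOps.

Section ComputableRecursion.
Context {X T : Type} {cX : coded X} {cT : coded T}.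

Lemma computable_iteri (cnt : X -> nat) (init : X -> T)
    (step : X -> nat -> T -> T) :
  computable (fun p : X * (nat * T) => step p.1 p.2.1 p.2.2) ->
  computable cnt -> computable init ->
  computable (fun x => iteri (cnt x) (step x) (init x)).
Proof.
move=> cs cc ci.
pose F (v : 1.-tuple nat) k r :=
  @enc _ cT (step (@dec _ cX (thead v)) k (@dec _ cT r)).
have rF : recursive (fun v : 3.-tuple nat =>
  F [tuple of behead [tuple of behead v]] (thead v) (thead [tuple of behead v])).
  pose q (v : 3.-tuple nat) : nat :=
    @enc _ (@coded_prod _ _ cX (@coded_prod _ _ coded_nat cT))
    (@dec _ cX (thead [tuple of behead [tuple of behead v]]),
     (thead v, @dec _ cT (thead [tuple of behead v]))).
  have rq : recursive q.
    apply: (@rec_ext _ (fun v : 3.-tuple nat =>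
        pair_code (thead [tuple of behead [tuple of behead v]],
                   pair_code (thead v, thead [tuple of behead v])))) => [v|].
      by rewrite /q /enc /= /prod_enc /= /prod_enc /= !decK.
    apply: recursive_pair_code.
      exact: (@recursive_behead 2 _ (@recursive_behead 1 _ (rec_proj ord0))).
    apply: recursive_pair_code; first exact: rec_proj.
    exact/recursive_behead/rec_proj.
  have rs := @recursive_apply1 3 (fun m => @enc _ cT
    ((fun p : X * (nat * T) => step p.1 p.2.1 p.2.2) (dec m))) q cs rq.
  by apply: rec_ext rs => v; rewrite /F /q encK.
have := @recursive_iteri 1 (fun k r v => F v k r) _ _ rF cc ci.
apply: rec_ext => v.
by elim: (cnt _) => //= k ->; rewrite /F encK.
Qed.

(** A conditional is an iteration of length 0 or 1 that replaces [g x] by [f x]. *)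
Lemma computable_if (b : X -> bool) (f g : X -> T) :
  computable (fun x => b x : nat) -> computable f -> computable g ->
  computable (fun x => if b x then f x else g x).
Proof.
move=> cb cf cg.
have c := @computable_iteri (fun x => b x) g (fun x _ _ => f x) _ cb cg.
apply: computable_ext (c _) => [x|]; first by case: (b x).
exact/(computable_comp cf)/computable_fst/computable_id.
Qed.

End ComputableRecursion.

Lemma computable_comp2 {X T U V : Type} {cX : coded X} {cT : coded T}
    {cU : coded U} {cV : coded V} (F : T -> U -> V) (f : X -> T) (g : X -> U) :
  computable (fun p : T * U => F p.1 p.2) -> computable f -> computable g ->
  computable (fun x => F (f x) (g x)).
Proof.
move=> cF cf cg.
exact: (computable_comp (f := fun p => F p.1 p.2) cF (computable_pair cf cg)).
Qed.

Section ComputableBool.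
Context {X : Type} {cX : coded X}.
Implicit Types b c : X -> bool.

Lemma computable_and b c :
  computable (fun x => b x : nat) -> computable (fun x => c x : nat) ->
  computable (fun x => b x && c x : nat).
Proof.
move=> cb cc; have h := computable_if cb cc (computable_const 0).
by apply: computable_ext h => x; case: (b x).
Qed.

Lemma computable_or b c :
  computable (fun x => b x : nat) -> computable (fun x => c x : nat) ->
  computable (fun x => b x || c x : nat).
Proof.
move=> cb cc; have h := computable_if cb (computable_const 1) cc.
by apply: computable_ext h => x; case: (b x).
Qed.

Lemma computable_not b :
  computable (fun x => b x : nat) -> computable (fun x => ~~ b x : nat).
Proof.
by move=> /computable_eq0 cb; apply: computable_ext cb => x; case: (b x).
Qed.

Lemma computable_subn (f g : X -> nat) :
  computable f -> computable g -> computable (fun x => f x - g x).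
Proof.
move=> cf cg; apply: (@computable_ext _ _ _ _
    (fun x => iteri (g x) (fun _ => predn) (f x))) => [x|].
  by elim: (g x) => /= [|k ->]; rewrite ?subn0 // subnS.
apply: (computable_iteri (step := fun _ _ => predn)) => //.
exact/computable_pred/computable_snd/computable_snd/computable_id.
Qed.

Lemma computable_leq (f g : X -> nat) :
  computable f -> computable g -> computable (fun x => f x <= g x : nat).
Proof. by move=> cf cg; apply/computable_eq0/computable_subn. Qed.

Lemma computable_eqn (f g : X -> nat) :
  computable f -> computable g -> computable (fun x => f x == g x : nat).
Proof.
move=> cf cg.
have h := computable_and (computable_leq cf cg) (computable_leq cg cf).
by apply: computable_ext h => x; rewrite eqn_leq.
Qed.

(** Turns an existence proved classically into a computable choice; the orders of elements and the
    exponent bounds are obtained in this way. *)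
Lemma computable_search (p : X -> nat -> bool) :
  (forall x, exists k, p x k) ->
  computable (fun q : X * nat => p q.1 q.2 : nat) ->
  exists2 f : X -> nat, computable f & forall x, p x (f x).
Proof.
move=> ex cp; exists (fun x => ex_minn (ex x)) => [|x]; last by case: ex_minnP.
apply: (@recursive_search 1 (fun k v => p (dec (thead v)) k)
  (fun v => ex (dec (thead v)))).
apply/recursive_eq0.
pose q (v : 2.-tuple nat) : nat := @enc _ (@coded_prod _ _ cX coded_nat)
  (@dec _ cX (thead [tuple of behead v]), thead v).
have rq : recursive q.
  apply: (@rec_ext _ (fun v : 2.-tuple nat =>
    pair_code (thead [tuple of behead v], thead v))) => [v|].
    by rewrite /q /enc /= /prod_enc /= decK.
  apply: recursive_pair_code; last exact: rec_proj.
  exact: (@recursive_behead 1 _ (rec_proj ord0)).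
have r := @recursive_apply1 2
  (fun m => p (@dec (X * nat) _ m).1 (@dec (X * nat) _ m).2) q cp rq.
by apply: rec_ext r => v; rewrite /q encK.
Qed.

End ComputableBool.

Section ComputableSeq.
Context {X T U : Type} {cX : coded X} {cT : coded T} {cU : coded U}.

Lemma seq_enc_cons (a : T) s : enc (a :: s) = (enc (a, s)).+1.
Proof.
by rewrite [enc (a, s)]pair_codeE /= prednK // muln_gt0 expn_gt0.
Qed.

Lemma computable_cons (f : X -> T) (g : X -> seq T) :
  computable f -> computable g -> computable (fun x => f x :: g x).
Proof.
move=> cf cg; apply: (@computable_ext _ _ _ _
    (fun x => dec (enc (f x, g x)).+1)) => [x|].
  by rewrite -seq_enc_cons encK.
exact/computable_dec/computable_succ/computable_enc/computable_pair.
Qed.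

(** The code of a list bounds the number of iterations needed to traverse it. *)
Lemma size_leq_enc (s : seq T) : size s <= enc s.
Proof.
elim: s => // a s IH; rewrite seq_enc_cons [size _]/= ltnS; apply: (leq_trans IH).
rewrite [enc (a, s)]pair_codeE /= -[leqRHS]addn0 -(subnn 1) addnBA //.
rewrite -ltnS subn1 addn1 /= prednK ?muln_gt0 ?expn_gt0 //.
apply: (@leq_trans (enc s).*2.+1); first by rewrite ltnS -addnn leq_addr.
by rewrite leq_pmull // expn_gt0.
Qed.

(** The state consists of the remaining list and the accumulator. The empty list has code 0 and is
    left fixed, so surplus iterations are harmless. *)
Definition foldl_step (f : U -> T -> U) (q : seq T * U) : seq T * U :=
  if enc q.1 == 0 then q else
  let p : T * seq T := dec (enc q.1).-1 in (p.2, f q.2 p.1).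

Lemma foldl_step_cons (f : U -> T -> U) a s u :
  foldl_step f (a :: s, u) = (s, f u a).
Proof.
by rewrite /foldl_step [(_, _).1]/= seq_enc_cons [_.+1.-1]/= encK.
Qed.

Lemma computable_foldl (step : X -> U -> T -> U) (init : X -> U)
    (l : X -> seq T) :
  computable (fun p : X * (U * T) => step p.1 p.2.1 p.2.2) ->
  computable init -> computable l ->
  computable (fun x => foldl (step x) (init x) (l x)).
Proof.
move=> cs ci cl.
have cn : computable (fun p : X * (nat * (seq T * U)) =>
    foldl_step (step p.1) p.2.2).
  have c2 : computable (fun p : X * (nat * (seq T * U)) => p.2.2).
    exact/computable_snd/computable_snd/computable_id.
  have cu : computable (fun p : X * (nat * (seq T * U)) =>
      dec (enc p.2.2.1).-1 : T * seq T).
    exact/computable_dec/computable_pred/computable_enc/computable_fst.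
  apply: computable_if => //.
    exact/computable_eq0/computable_enc/computable_fst.
  apply: computable_pair; first exact: computable_snd.
  have cp : computable (fun p : X * (nat * (seq T * U)) =>
      (p.1, (p.2.2.2, (dec (enc p.2.2.1).-1 : T * seq T).1))).
    apply: computable_pair; first exact/computable_fst/computable_id.
    by apply: computable_pair; [exact: computable_snd|exact: computable_fst].
  exact: (computable_comp (f := fun p : X * (U * T) => step p.1 p.2.1 p.2.2) cs cp).
apply: (@computable_ext _ _ _ _ (fun x =>
    (iteri (enc (l x)) (fun _ => foldl_step (step x)) (l x, init x)).2))
  => [x|]; last first.
  apply: computable_snd.
  apply: (computable_iteri (step := fun x _ => foldl_step (step x))) => //.
  exact: computable_pair.
have -> k z : iteri k (fun _ => foldl_step (step x)) z =
      iter k (foldl_step (step x)) z.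
  by elim: k => //= k ->.
elim: (l x) (enc (l x)) (size_leq_enc (l x)) (init x) => [|a s IH] [|k] //= ks u.
  by rewrite -iterS iter_fix.
by rewrite -iterS iterSr foldl_step_cons IH.
Qed.

End ComputableSeq.

Section ComputableSeqOps.
Context {X T U : Type} {cX : coded X} {cT : coded T} {cU : coded U}.

Lemma computable_rev (l : X -> seq T) :
  computable l -> computable (fun x => rev (l x)).
Proof.
move=> cl; apply: (@computable_ext _ _ _ _
    (fun x => foldl (fun s a => a :: s) [::] (l x))) => [x|].
  by rewrite /rev; elim: (l x) [::] => //= a s IH z; rewrite IH.
apply: (computable_foldl (step := fun _ s a => a :: s)) cl => //.
  apply: computable_cons; first exact/computable_snd/computable_snd/computable_id.
  exact/computable_fst/computable_snd/computable_id.
exact: computable_const.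
Qed.

Lemma computable_foldr (step : X -> T -> U -> U) (init : X -> U)
    (l : X -> seq T) :
  computable (fun p : X * (T * U) => step p.1 p.2.1 p.2.2) ->
  computable init -> computable l ->
  computable (fun x => foldr (step x) (init x) (l x)).
Proof.
move=> cs ci cl; apply: (@computable_ext _ _ _ _
    (fun x => foldl (fun u a => step x a u) (init x) (rev (l x)))) => [x|].
  by rewrite foldl_rev.
apply: (computable_foldl (step := fun x u a => step x a u)) ci _; last first.
  exact: computable_rev.
have cp : computable (fun p : X * (U * T) => (p.1, (p.2.2, p.2.1))).
  apply: computable_pair; first exact/computable_fst/computable_id.
  apply: computable_pair; first exact/computable_snd/computable_snd/computable_id.
  exact/computable_fst/computable_snd/computable_id.
exact: (computable_comp (f := fun p : X * (T * U) => step p.1 p.2.1 p.2.2) cs cp).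
Qed.

End ComputableSeqOps.

Lemma computable_step1 {X T U V : Type} {cX : coded X} {cT : coded T}
    {cU : coded U} {cV : coded V} (f : X -> T -> V) :
  computable (fun p : X * T => f p.1 p.2) ->
  computable (fun p : X * (T * U) => f p.1 p.2.1).
Proof.
move=> cf; apply: (computable_comp2 cf); first exact/computable_fst/computable_id.
exact/computable_fst/computable_snd/computable_id.
Qed.

Section ComputableSeqFunctions.
Context {X T U : Type} {cX : coded X} {cT : coded T} {cU : coded U}.

Lemma computable_cat (f g : X -> seq T) :
  computable f -> computable g -> computable (fun x => f x ++ g x).
Proof.
move=> cf cg; apply: (@computable_ext _ _ _ _
    (fun x => foldr (fun a s => a :: s) (g x) (f x))) => [x|].
  by elim: (f x) => //= a s ->.
apply: (computable_foldr (step := fun _ a s => a :: s)) cg cf.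
apply: computable_cons; first exact/computable_fst/computable_snd/computable_id.
exact/computable_snd/computable_snd/computable_id.
Qed.

Lemma computable_map (f : X -> T -> U) (l : X -> seq T) :
  computable (fun p : X * T => f p.1 p.2) -> computable l ->
  computable (fun x => map (f x) (l x)).
Proof.
move=> cf cl; apply: (@computable_ext _ _ _ _
    (fun x => foldr (fun a s => f x a :: s) [::] (l x))) => //.
apply: (computable_foldr (step := fun x a s => f x a :: s))
  (computable_const _) cl.
apply: computable_cons; first exact: computable_step1.
exact/computable_snd/computable_snd/computable_id.
Qed.

Lemma computable_all (p : X -> T -> bool) (l : X -> seq T) :
  computable (fun q : X * T => p q.1 q.2 : nat) -> computable l ->
  computable (fun x => all (p x) (l x) : nat).
Proof.
move=> cp cl; apply: (@computable_ext _ _ _ _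
    (fun x => foldr (fun a (r : nat) => p x a && (r != 0) : nat) 1 (l x))) => [x|].
  by elim: (l x) => //= a s ->; case: (p x a) => //=; case: all.
apply: (computable_foldr (step := fun x a (r : nat) => p x a && (r != 0) : nat))
  (computable_const _) cl.
apply: computable_and.
  exact: (computable_step1 (f := fun x a => p x a : nat)).
exact/computable_not/computable_eq0/computable_snd/computable_snd/computable_id.
Qed.

Lemma computable_has (p : X -> T -> bool) (l : X -> seq T) :
  computable (fun q : X * T => p q.1 q.2 : nat) -> computable l ->
  computable (fun x => has (p x) (l x) : nat).
Proof.
move=> cp cl.
apply: (@computable_ext _ _ _ _
    (fun x => ~~ all (fun y => ~~ p x y) (l x) : nat)) => [x|].
  by rewrite -has_predC; congr nat_of_bool; apply: eq_has => y /=; rewrite negbK.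
apply/computable_not/(computable_all (p := fun x y => ~~ p x y)) => //.
exact: computable_not.
Qed.

Lemma computable_filter (p : X -> T -> bool) (l : X -> seq T) :
  computable (fun q : X * T => p q.1 q.2 : nat) -> computable l ->
  computable (fun x => filter (p x) (l x)).
Proof.
move=> cp cl; apply: (@computable_ext _ _ _ _
    (fun x => foldr (fun a s => if p x a then a :: s else s) [::] (l x))) => //.
apply: (computable_foldr (step := fun x a s => if p x a then a :: s else s))
  (computable_const _) cl.
have cs : computable (fun p : X * (T * seq T) => p.2.2).
  exact/computable_snd/computable_snd/computable_id.
apply: computable_if => //.
  exact: (computable_step1 (f := fun x a => p x a : nat)).
apply: computable_cons => //.
exact/computable_fst/computable_snd/computable_id.
Qed.

(** The table [t] is a constant, so its entries may come from an ineffective choice. *)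
Lemma computable_nth (d : U) (t : seq U) (f : X -> nat) :
  computable f -> computable (fun x => nth d t (f x)).
Proof.
elim: t f => [|a t IH] f cf.
  by apply: computable_ext (computable_const d) => x; rewrite nth_nil.
have h := computable_if (computable_eq0 cf) (computable_const a)
  (IH _ (computable_pred cf)).
by apply: computable_ext h => x; case: (f x).
Qed.

End ComputableSeqFunctions.

Section ComputableFlatten.
Context {X T : Type} {cX : coded X} {cT : coded T}.

Lemma computable_flatten (l : X -> seq (seq T)) :
  computable l -> computable (fun x => flatten (l x)).
Proof.
move=> cl; apply: (@computable_ext _ _ _ _ (fun x => foldr cat [::] (l x))) => //.
apply: (computable_foldr (step := fun _ => cat))
  (computable_const _) cl.
apply: computable_cat; first exact/computable_fst/computable_snd/computable_id.
exact/computable_snd/computable_snd/computable_id.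
Qed.

Lemma computable_iota (n : X -> nat) :
  computable n -> computable (fun x => iota 0 (n x)).
Proof.
move=> cn.
have c : computable (fun x =>
    iteri (n x) (fun k (s : seq nat) => s ++ [:: k]) [::]).
  apply: (computable_iteri (step := fun _ k s => s ++ [:: k])) => //.
    apply: computable_cat; first exact/computable_snd/computable_snd/computable_id.
    apply: computable_cons (computable_const _).
    exact/computable_fst/computable_snd/computable_id.
  exact: computable_const.
apply: computable_ext c => x; elim: (n x) => //= k ->.
by rewrite -(iotaD 0 k 1) addn1.
Qed.

End ComputableFlatten.

(** * Cosets of cyclic subgroups and cohomologous functions *)

Section Cosets.
Variable B : groupType.
Implicit Types b c d r s t : B.
Local Open Scope group_scope.

(* [s] and [t] lie in the same left coset of the cyclic group generated by [c];
   two natural exponents avoid negative powers. *)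
Definition same_coset c s t : Prop := exists i j : nat, s * c ^+ i = t * c ^+ j.

Lemma same_coset_refl c s : same_coset c s s.
Proof. by exists 0, 0. Qed.

Lemma same_coset_sym c s t : same_coset c s t -> same_coset c t s.
Proof. by case=> i [j e]; exists j, i. Qed.

Lemma same_coset_trans c s t r :
  same_coset c s t -> same_coset c t r -> same_coset c s r.
Proof.
case=> i [j e] [k [l e']]; exists (i + k)%N, (j + l)%N.
by rewrite expgnDr mulgA e -mulgA -expgnDr addnC expgnDr mulgA e' -mulgA
  -expgnDr addnC.
Qed.

Lemma same_coset_mulX c s k : same_coset c (s * c ^+ k) s.
Proof. by exists 0, k; rewrite mulg1. Qed.

Lemma same_coset_mulVX c s k : same_coset c (s * c ^- k) s.
Proof. by exists k, 0; rewrite mulgVK mulg1. Qed.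

Lemma same_coset_mull c d s t :
  same_coset c (d * s) (d * t) <-> same_coset c s t.
Proof.
split=> -[i [j e]]; exists i, j; last by rewrite -!mulgA e.
by move: e; rewrite -!mulgA => /mulgI.
Qed.

Lemma same_coset1 c s : same_coset c s 1 <-> exists n : int, s = zexpg c n.
Proof.
split=> [[i [j]]|[[k|k] ->]]; last first.
- by exists k.+1, 0; rewrite mulVg mulg1.
- by exists 0, k; rewrite mul1g mulg1.
rewrite mul1g => e; have es : s = c ^+ j * c ^- i by rewrite -e mulgK.
have [ij|ji] := leqP i j.
  by exists (Posz (j - i)); rewrite es /= expgnFr.
exists (Negz (i - j).-1); rewrite es /= prednK ?subn_gt0 // expgnFr ?(ltnW ji) //.
by rewrite invgM invgK.
Qed.

Definition infinite_order c : Prop := ~ finite_order c.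

Lemma infinite_orderX_inj c r i j :
  infinite_order c -> r * c ^+ i = r * c ^+ j -> i = j.
Proof.
move=> inf /mulgI.
wlog ij : i j / i <= j => [hw|e].
  by have [ij|/ltnW ji] := leqP i j => e; [|apply/esym]; apply: hw.
move: ij; rewrite leq_eqVlt => /orP[/eqP//|ij]; case: inf.
exists (j - i); first by rewrite subn_gt0.
by rewrite expgnFr ?(ltnW ij) // -e mulgV.
Qed.

Lemma finite_order_min c : finite_order c ->
  exists n, [/\ 0 < n, c ^+ n = 1 & forall k, 0 < k < n -> c ^+ k <> 1].
Proof.
move=> [n n0 cn].
have ex : exists n, (0 < n) && (c ^+ n == 1) by exists n; rewrite n0 cn eqxx.
case: (ex_minnP ex) => m /andP[m0 /eqP cm] mmin; exists m; split=> // k.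
case/andP=> k0 km /eqP ck; have := mmin k; rewrite k0 ck => /(_ isT).
by rewrite leqNgt km.
Qed.

Lemma orderX_inj c r n : (forall k, 0 < k < n -> c ^+ k <> 1) ->
  forall i j, i < n -> j < n -> r * c ^+ i = r * c ^+ j -> i = j.
Proof.
move=> min i j + + /mulgI.
wlog ij : i j / i <= j => [hw|ni nj e].
  by have [ij|/ltnW ji] := leqP i j => ? ? e; [|apply/esym]; apply: hw.
move: ij; rewrite leq_eqVlt => /orP[/eqP//|ij].
case: (min (j - i)).
  by rewrite subn_gt0 ij /= (leq_ltn_trans _ nj) // leq_subr.
by rewrite expgnFr ?(ltnW ij) // -e mulgV.
Qed.

Lemma same_coset_window c n r s : 0 < n -> c ^+ n = 1 -> same_coset c s r ->
  exists2 k, k < n & s = r * c ^+ k.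
Proof.
move=> n0 cn [i [j e]].
(* As [c ^+ n = 1], the inverse of [c ^+ i] is [c ^+ (i * n.-1)], so this exponent represents j -
   i. *)
exists ((j + i * n.-1) %% n); first by rewrite ltn_mod.
rewrite -[c ^+ _]mul1g -(expg1n _ ((j + i * n.-1) %/ n)) -cn -expgnA -expgnDr.
rewrite mulnC -divn_eq expgnDr mulgA -e -mulgA -expgnDr.
by rewrite -mulnS prednK // mulnC expgnA cn expg1n mulg1.
Qed.

(** Pigeonhole. Applied to the support of [h] along an infinite coset, it produces a point on each
    ray where [h] is 1. *)
Lemma injective_exits (S : {fset B}) (f : nat -> B) :
  injective f -> exists k, f k \notin S.
Proof.
move=> inj; apply: contrapT => none.
have sub : {subset map f (iota 0 #|`S|.+1) <= enum_fset S}.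
  move=> _ /mapP[k _ ->]; apply: contrapT => /negP fk; apply: none.
  by exists k.
have : uniq (map f (iota 0 #|`S|.+1)) by rewrite map_inj_uniq ?iota_uniq.
by move/uniq_leq_size => /(_ _ sub); rewrite size_map size_iota cardfE ltnNge leqnn.
Qed.

End Cosets.

Section Interpolation.
Variables A B : groupType.
Local Notation afun := {fsfun B -> A with 1%g}.

Lemma fsfun_interpolation (f : nat -> B) (H : nat -> A) m :
  (forall i j, i < m -> j < m -> f i = f j -> i = j) ->
  exists h : afun, (forall k, k < m -> h (f k) = H k) /\
    (forall s, (forall k, k < m -> s <> f k) -> h s = 1%g).
Proof.
elim: m => [|m IH] inj.
  by exists (fun_one A B); split=> // s _; rewrite fsfun0E.
have [|h [hf h1]] := IH; first by move=> i j /ltnW im /ltnW jm; exact: inj.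
exists [fsfun h with f m |-> H m]; split=> [k|s sf].
  rewrite ltnS leq_eqVlt fsfun_withE => /orP[/eqP->|km]; first by rewrite eqxx.
  case: eqP => [fkm|_]; last exact: hf.
  by move: (km); rewrite (inj k m) ?ltnn // ltnS ltnW.
rewrite fsfun_withE; case: eqP => [/sf|_]; first by case/(_ (ltnSn m)).
by apply: h1 => k km; apply: sf; exact: ltnW.
Qed.

End Interpolation.

Section Cohomology.
Variables A B : groupType.
Local Notation afun := {fsfun B -> A with 1%g}.
Implicit Types (b c d r s t : B) (F G : B -> A) (h : afun).
Local Open Scope group_scope.

(** The support stays in the union of the two given supports, whatever [Q] is; so functions can be
    glued along infinite unions of cosets. *)
Lemma fsfun_patch (Q : B -> Prop) (h1 h2 : afun) :
  exists h : afun, forall s, (Q s -> h s = h1 s) /\ (~ Q s -> h s = h2 s).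
Proof.
exists [fsfun s in (finsupp h1 `|` finsupp h2)%fset =>
  if `[< Q s >] then h1 s else h2 s] => s.
rewrite fsfunE inE; case: ifP => [_|/negbT].
  by split=> q; [rewrite asboolT|rewrite asboolF].
by rewrite negb_or => /andP[s1 s2]; rewrite !fsfun_dflt.
Qed.

Definition cohomologous c F G : Prop :=
  exists h, forall s, F s * h s = h (s * c^-1) * G s.

Definition cohomologous_at c r F G : Prop :=
  exists h, forall s, same_coset c s r -> F s * h s = h (s * c^-1) * G s.

Definition coset_prod F r c n : A :=
  iteri n (fun k z => z * F (r * c ^+ k)) 1.

Lemma same_coset_Vr c s t : same_coset c (s * c^-1) t <-> same_coset c s t.
Proof.
split; apply: same_coset_trans; last exact: (same_coset_mulVX c s 1).
exact/same_coset_sym/(same_coset_mulVX c s 1).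
Qed.

(** The equation links [s] only with [s * c^-1], which lies in the same coset, so it is solved coset
    by coset. Off the cosets listed by [T] both functions are 1 and h = 1 is a solution; only
    finitely many local solutions have to be glued, which keeps the support finite. *)
Lemma cohomologousP c F G (T : seq B) :
  (forall s, F s <> 1 \/ G s <> 1 -> exists2 t, t \in T & same_coset c s t) ->
  cohomologous c F G <-> forall t, t \in T -> cohomologous_at c t F G.
Proof.
move=> supp; split=> [[h eh] t _|]; first by exists h => s _; exact: eh.
move=> loc.
suff [h [hT hN]] : exists h, (forall s, (exists2 t, t \in T & same_coset c s t) ->
    F s * h s = h (s * c^-1) * G s) /\
    forall s, ~ (exists2 t, t \in T & same_coset c s t) -> h s = 1.
  exists h => s; have [/hT//|nT] := pselect (exists2 t, t \in T & same_coset c s t).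
  have F1 : F s = 1 by apply: contrapT => Fs; apply: nT; apply: supp; left.
  have G1 : G s = 1 by apply: contrapT => Gs; apply: nT; apply: supp; right.
  rewrite F1 G1 !hN // => -[t tT] /same_coset_Vr st; apply: nT.
  by exists t.
elim: T {supp} loc => [|t T IH] loc.
  by exists (fun_one A B); split=> [s []//|s _]; rewrite fsfun0E.
have [|h1 [hT hN]] := IH; first by move=> u uT; apply: loc; rewrite inE uT orbT.
have [h2 h2t] := loc t (mem_head _ _).
have [h hP] := fsfun_patch (fun s => same_coset c s t) h2 h1.
exists h; split=> s.
  have [st _|nst] := pselect (same_coset c s t).
    rewrite (hP s).1 // (hP (s * c^-1)).1 ?h2t //; exact/same_coset_Vr.
  move=> [u]; rewrite inE => /orP[/eqP->//|uT su].
  rewrite (hP s).2 // (hP (s * c^-1)).2 ?hT //; first by exists u.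
  by move/same_coset_Vr.
move=> nT; rewrite (hP s).2 ?hN //.
  by move=> [u uT su]; apply: nT; exists u; rewrite // inE uT orbT.
by move=> st; apply: nT; exists t; rewrite // mem_head.
Qed.

Lemma coset_prodS F r c n :
  coset_prod F r c n.+1 = coset_prod F r c n * F (r * c ^+ n).
Proof. by []. Qed.

Lemma mulg_step c r k : r * c ^+ k.+1 * c^-1 = r * c ^+ k.
Proof. by rewrite expgSr mulgA mulgK. Qed.

Lemma coset_prod_telescope c F G h r n :
  (forall k, k < n ->
    F (r * c ^+ k) * h (r * c ^+ k) = h (r * c ^+ k * c^-1) * G (r * c ^+ k)) ->
  coset_prod F r c n * h (r * c ^+ n * c^-1) =
  h (r * c^-1) * coset_prod G r c n.
Proof.
elim: n => [|n IH] eh; first by rewrite /= !mulg1 mul1g.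
rewrite !coset_prodS mulg_step -mulgA eh // mulgA IH ?mulgA // => k kn.
by apply: eh; exact: ltnW.
Qed.

(** After [n] steps the telescoped identity is back at [r * c^-1], so [h] has the same value at both
    ends, and this value conjugates one product into the other. *)
Lemma cohomologous_at_finite c F G r n :
  0 < n -> c ^+ n = 1 -> (forall k, 0 < k < n -> c ^+ k <> 1) ->
  cohomologous_at c r F G <->
  exists z, coset_prod G r c n = coset_prod F r c n ^ z.
Proof.
move=> n0 cn cmin; split=> [[h eh]|[z ez]].
  exists (h (r * c^-1)); rewrite conjgE.
  have := @coset_prod_telescope c F G h r n
    (fun k _ => eh _ (same_coset_mulX c r k)).
  by rewrite cn mulg1 => ->; rewrite mulKg.
(* The cocycle equation determines h along the coset from its value z at r c^-1. *)
pose H k := (coset_prod F r c k.+1)^-1 * z * coset_prod G r c k.+1.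
have [h [hH _]] := fsfun_interpolation H (orderX_inj (r := r) cmin).
exists h => s /(same_coset_window n0 cn)[[|k] kn ->].
  rewrite hH // /H mulg1.
  (* At the first point the equation closes the cycle: the predecessor is the last point, where [ez]
     makes [H] equal to [z] again. *)
  have -> : r * c^-1 = r * c ^+ n.-1.
    by rewrite -mulg_step prednK // cn mulg1.
  have Hn : H n.-1 = z by rewrite /H prednK // ez conjgE !mulgA mulgK mulVg mul1g.
  by rewrite hH ?prednK // Hn /H !coset_prodS /= !mul1g !mulgA mulg1 mulgV mul1g.
rewrite mulg_step !hH //; last exact: ltnW.
by rewrite /H 2!coset_prodS invgM !mulgA mulgV mul1g.
Qed.

Definition in_window c r m F : Prop :=
  forall s, same_coset c s r -> F s <> 1 -> exists2 k, k < m & s = r * c ^+ k.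

Lemma in_window_out c r m F k : infinite_order c -> in_window c r m F ->
  m <= k -> F (r * c ^+ k) = 1.
Proof.
move=> inf win mk; apply: contrapT => /(win _ (same_coset_mulX c r k))[j jm].
by move/(infinite_orderX_inj inf) => kj; move: mk; rewrite kj leqNgt jm.
Qed.

Lemma infinite_orderXV c r k j :
  infinite_order c -> r * c ^- k.+1 <> r * c ^+ j.
Proof.
move=> inf e; have : r * c ^+ 0 = r * c ^+ (j + k.+1).
  by rewrite expgnDr mulgA -e mulgVK mulg1.
by move/(infinite_orderX_inj inf); rewrite addnS.
Qed.

Lemma in_window_outV c r m F k : infinite_order c -> in_window c r m F ->
  F (r * c ^- k.+1) = 1.
Proof.
move=> inf win; apply: contrapT => /(win _ (same_coset_mulVX c r _))[j _].
exact: infinite_orderXV.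
Qed.

(** Outside the window both functions are 1, so [h] is constant on the ray before it and on the ray
    from its last point on. Finite support forces both constants to be 1, and telescoping over the
    window leaves an equality. *)
Lemma cohomologous_at_infinite c F G r m :
  infinite_order c -> in_window c r m F -> in_window c r m G ->
  cohomologous_at c r F G <-> coset_prod F r c m = coset_prod G r c m.
Proof.
move=> inf wF wG; split=> [[h eh]|ez].
  have hV j : h (r * c^-1) = h (r * c ^- j.+1).
    elim: j => // j ->; have := eh _ (same_coset_mulVX c r j.+1).
    rewrite (in_window_outV j inf wF) (in_window_outV j inf wG) mul1g mulg1 => ->.
    by rewrite -mulgA -invgM -expgS.
  have hX j : h (r * c ^+ m * c^-1) = h (r * c ^+ (m + j) * c^-1).
    elim: j => [|j ->]; first by rewrite addn0.
    rewrite addnS mulg_step; have := eh _ (same_coset_mulX c r (m + j)).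
    rewrite (in_window_out inf wF) ?leq_addr //.
    by rewrite (in_window_out inf wG) ?leq_addr // mul1g mulg1.
  have h1 : h (r * c^-1) = 1.
    have [i j /mulgI/invg_inj|j hj] := @injective_exits _ (finsupp h)
      (fun j => r * c ^- j.+1).
      rewrite -[c ^+ i.+1]mul1g -[c ^+ j.+1]mul1g.
      by case/(infinite_orderX_inj inf).
    by rewrite (hV j) fsfun_dflt.
  have h2 : h (r * c ^+ m * c^-1) = 1.
    have [i j|j hj] := @injective_exits _ (finsupp h)
      (fun j => r * c ^+ (m + j) * c^-1).
      by move/mulIg/(infinite_orderX_inj inf)/addnI.
    by rewrite (hX j) fsfun_dflt.
  have := @coset_prod_telescope c F G h r m
    (fun k _ => eh _ (same_coset_mulX c r k)).
  by rewrite h1 h2 mulg1 mul1g.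
(* The equation is solved from left to right, starting from the value 1 before the window. *)
pose H k := (coset_prod F r c k.+1)^-1 * coset_prod G r c k.+1.
have [h [hH hN]] := fsfun_interpolation H
  (fun i j (_ : i < m) (_ : j < m) => @infinite_orderX_inj _ c r i j inf).
exists h => s sr.
have [[k ->]|nk] := pselect (exists k, s = r * c ^+ k); last first.
  have F1 : F s = 1.
    by apply: contrapT => /(wF _ sr)[k _ ek]; apply: nk; exists k.
  have G1 : G s = 1.
    by apply: contrapT => /(wG _ sr)[k _ ek]; apply: nk; exists k.
  rewrite F1 G1 !hN // => k _ e; apply: nk; last by exists k.
  by exists k.+1; rewrite expgSr mulgA -e mulgVK.
have [mk|km] := leqP m k.
  rewrite (in_window_out inf wF mk) (in_window_out inf wG mk).
  rewrite mul1g mulg1 hN; last first.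
    by move=> j jm /(infinite_orderX_inj inf) kj; move: jm; rewrite -kj ltnNge mk.
  case: k mk => [|k] mk; last rewrite mulg_step.
    by rewrite hN // => j; move: mk; rewrite leqn0 => /eqP->.
  (* Just behind the window the predecessor is the last window point, where [ez] gives [H] the value
     1, in agreement with [h] being 1 outside. *)
  move: mk; rewrite leq_eqVlt => /orP[/eqP mk|mk].
    by rewrite hH ?mk // /H -mk ez mulVg.
  rewrite hN // => j jm /(infinite_orderX_inj inf) kj.
  by move: mk; rewrite kj ltnS leqNgt jm.
case: k km => [|k] km.
  rewrite hH // /H hN => [|j jm]; last first.
    by rewrite mulg1; exact: (@infinite_orderXV c r 0 j inf).
  by rewrite /= !mul1g !mulg1 mulgA mulgV mul1g.
rewrite mulg_step !hH //; last exact: ltnW.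
by rewrite /H 2!coset_prodS invgM !mulgA mulgV mul1g.
Qed.

End Cohomology.

(** * Conjugacy in the wreath product *)

Section WreathConjugacy.
Variables A B : groupType.
Local Notation W := (wreath A B).
Implicit Types (b c d r s t : B) (F G : B -> A) (x y z : W).
Local Open Scope group_scope.

Lemma wreath_baseM x y : wreath_base (x * y) = wreath_base x * wreath_base y.
Proof. by []. Qed.

Lemma wreath_baseV x : wreath_base x^-1 = (wreath_base x)^-1.
Proof. by []. Qed.

Lemma wreath_baseX x n : wreath_base (x ^+ n) = wreath_base x ^+ n.
Proof. by elim: n => // n IH; rewrite !expgS wreath_baseM IH. Qed.

Lemma wreath_funM x y s :
  wreath_fun (x * y) s = wreath_fun x (s * (wreath_base y)^-1) * wreath_fun y s.
Proof. by rewrite fun_mulE fun_actE. Qed.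

Lemma wreath_funV x s : wreath_fun x^-1 s = (wreath_fun x (s * wreath_base x))^-1.
Proof. by rewrite fun_actE fun_invE invgK. Qed.

Lemma wreath_fun1 s : wreath_fun (1 : W) s = 1.
Proof. by rewrite fsfun0E. Qed.

Lemma conj_base x y z : y = x ^ z ->
  wreath_base x * wreath_base z = wreath_base z * wreath_base y /\
  cohomologous (wreath_base y)
    (fun s => wreath_fun x (s * (wreath_base z)^-1)) (wreath_fun y).
Proof.
move=> e; have ez : x * z = z * y by rewrite e conjgE mulVKg.
split; first by rewrite -!wreath_baseM ez.
by exists (wreath_fun z) => s; rewrite -!wreath_funM ez.
Qed.

Lemma conj_ofbase x y d :
  wreath_base x * d = d * wreath_base y ->
  cohomologous (wreath_base y) (fun s => wreath_fun x (s * d^-1)) (wreath_fun y) ->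
  exists z, y = x ^ z.
Proof.
move=> ed [h eh]; exists (Wreath d h).
suff -> : x = Wreath d h * y * (Wreath d h)^-1 by rewrite conjgE mulgVK mulKg.
apply: (canRL (mulgK _)); apply: wreathP => [//|s].
by rewrite !wreath_funM eh.
Qed.

(** In the second alternative no coset of <c> meets both the translated support of [x] and the
    support of [y]; the two functions then do not interact, and each is cohomologous to 1 over its
    own base part. [Tx] and [Ty] may be larger than the supports, since a word only yields such
    supersets. *)
Lemma wreath_conjP x y (Tx Ty : seq B) :
  (forall s, wreath_fun x s <> 1 -> s \in Tx) ->
  (forall s, wreath_fun y s <> 1 -> s \in Ty) ->
  (exists z, y = x ^ z) <->
  (exists2 t, t \in Tx & exists2 s, s \in Ty &
     wreath_base x * (t^-1 * s) = (t^-1 * s) * wreath_base y /\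
     cohomologous (wreath_base y) (fun u => wreath_fun x (u * (t^-1 * s)^-1))
       (wreath_fun y)) \/
  [/\ exists d, wreath_base x * d = d * wreath_base y,
      cohomologous (wreath_base x) (wreath_fun x) (fun=> 1) &
      cohomologous (wreath_base y) (fun=> 1) (wreath_fun y)].
Proof.
set c := wreath_base y => xT yT; split=> [[z ez]|]; last first.
  case=> [[t _ [s _ [eb ec]]]|[[d ed] cx cy]]; first exact: conj_ofbase ec.
  (* The conjugation passes through the two elements with the same base parts and trivial
     functions. *)
  pose x1 : W := Wreath (wreath_base x) (fun_one A B).
  pose y1 : W := Wreath c (fun_one A B).
  have [||z1 e1] := @conj_ofbase x x1 1; first by rewrite mulg1 mul1g.
    case: cx => h eh; exists h => s /=.
    by rewrite fsfun0E invg1 mulg1 eh.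
  have [|z2 e2] := @conj_ofbase x1 y1 d ed.
    by exists (fun_one A B) => s; rewrite /= !fsfun0E.
  have [||z3 e3] := @conj_ofbase y1 y 1; first by rewrite mulg1 mul1g.
    by case: cy => h eh; exists h => s /=; rewrite fsfun0E eh.
  by exists (z1 * z2 * z3); rewrite e3 e2 e1 !conjgM.
set d := wreath_base z.
have [[t [s [tT sT ts]]]|none] := pselect (exists t s,
    [/\ t \in Tx, s \in Ty & same_coset c (t * d) s]).
  left; exists t => //; exists s => //.
  case: ts => i [j e].
  (* Powers of [y] fix [y] under conjugation, so [z] may be multiplied by them; the base part d
     becomes d c^i c^-j, which by [e] is t^-1 s. *)
  have ez' : y = x ^ (z * (y ^+ i * y ^- j)).
    have yX k : y ^ (y ^+ k) = y by apply/conjg_fixP; rewrite commgXg.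
    have yXV k : y ^ (y ^- k) = y by apply/conjg_fixP; rewrite commgXVg.
    by rewrite conjgM -ez conjgM yX yXV.
  have := conj_base ez'; suff -> : wreath_base (z * (y ^+ i * y ^- j)) = t^-1 * s.
    by [].
  rewrite wreath_baseM wreath_baseM wreath_baseV !wreath_baseX -/c -/d.
  by apply: (canRL (mulKg t)); rewrite !mulgA e mulgK.
have [ed [h eh]] := conj_base ez; right.
(* [Q] is invariant under translation by [c]; the translated function of [x] is 1 on it and that of
   [y] is 1 off it. Restricting [h] to the complement of [Q] therefore trivializes the first
   function, and restricting it to [Q] trivializes the second. *)
pose Q s := exists2 t, t \in Ty & same_coset c s t.
have QV s : Q (s * c^-1) <-> Q s.
  by split=> -[t tT /same_coset_Vr st]; exists t => //; apply/same_coset_Vr.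
have xQ s : Q s -> wreath_fun x (s * d^-1) = 1.
  move=> [t tT st]; apply: contrapT => /xT sT; apply: none.
  by exists (s * d^-1), t; split=> //; rewrite mulgVK.
have yQ s : ~ Q s -> wreath_fun y s = 1.
  move=> nQ; apply: contrapT => /yT sT; apply: nQ; exists s => //.
  exact: same_coset_refl.
split; first by exists d.
  have [h' hP] := fsfun_patch Q (fun_one A B) h.
  (* [h'] solves the equation translated by [d] over [c]; acting by [d^-1] moves the solution back
     over the base part of [x]. *)
  exists (fun_act h' d^-1) => s; rewrite !fun_actE invgK.
  have -> : s * (wreath_base x)^-1 * d = s * d * c^-1.
    rewrite -!mulgA; congr (s * _); apply: (canLR (mulKg _)).
    by rewrite mulgA ed mulgK.
  have [q|nq] := pselect (Q (s * d)).
    rewrite !(hP _).1 // ?fsfun0E ?mulg1; last exact/QV.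
    by have := xQ _ q; rewrite mulgK.
  rewrite !(hP _).2 ?QV //; have := eh (s * d).
  by rewrite mulgK -/d -/c => ->; rewrite yQ.
have [h' hP] := fsfun_patch Q h (fun_one A B).
exists h' => s; have [q|nq] := pselect (Q s).
  rewrite !(hP _).1 ?QV //; have := eh s.
  by rewrite -/d -/c xQ.
by rewrite !(hP _).2 ?QV // !fsfun0E yQ.
Qed.

End WreathConjugacy.

(** * Functions given by lists of points and values; the abelian case *)

Section ListFunctions.
Variables A B : groupType.
Implicit Types (c r s t : B) (L M : seq (B * A)) (F G : B -> A).
Local Open Scope group_scope.

(** Points may repeat, as they do in the list read off a word, where equality of points is not
    resolved. *)
Definition list_fun L s : A := \prod_(p <- L | p.1 == s) p.2.

Lemma list_fun_cons p L s :
  list_fun (p :: L) s = (if p.1 == s then p.2 else 1) * list_fun L s.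
Proof. by rewrite /list_fun big_cons; case: eqP => // _; rewrite mul1g. Qed.

Lemma list_fun_supp L s : list_fun L s <> 1 -> s \in map fst L.
Proof.
elim: L => [|p L IH]; first by rewrite /list_fun big_nil.
rewrite list_fun_cons inE eq_sym; case: eqP => //= _.
by rewrite mul1g.
Qed.

(** A single bound gives a common window for all points of [T]. For given [N] it can be tested with
    the power and word problems, hence it can be found by search. *)
Definition coset_bound c N (T : seq B) : Prop :=
  {in T &, forall s t, same_coset c s t ->
    exists i j, [/\ i <= N, j <= N & s * c ^+ i = t * c ^+ j]}.

Lemma coset_bound_ex c T : exists N, coset_bound c N T.
Proof.
elim: T => [|u T [N NT]]; first by exists 0.
have [K KT] : exists K, forall t, t \in T -> same_coset c u t ->
    exists i j, [/\ i <= K, j <= K & u * c ^+ i = t * c ^+ j].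
  elim: T {NT} => [|t T [K KT]]; first by exists 0.
  have [[i [j e]]|nut] := pselect (same_coset c u t); last first.
    by exists K => v; rewrite inE => /orP[/eqP-> /nut//|/KT].
  exists (maxn K (maxn i j)) => v; rewrite inE => /orP[/eqP->|/KT h /h].
    by exists i, j; rewrite !leq_max !leqnn !orbT.
  by move=> [k [l [kK lK e']]]; exists k, l; rewrite !leq_max kK lK.
exists (maxn N K) => s t; rewrite !inE => /orP[/eqP->|sT] /orP[/eqP->|tT] st.
- by exists 0, 0.
- have [i [j [iK jK e]]] := KT t tT st.
  by exists i, j; rewrite !leq_max iK jK !orbT.
- have [i [j [iK jK e]]] := KT s sT (same_coset_sym st).
  by exists j, i; rewrite !leq_max iK jK !orbT.
have [i [j [iN jN e]]] := NT s t sT tT st.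
by exists i, j; rewrite !leq_max iN jN.
Qed.

Lemma coset_bound_window c N T r s : coset_bound c N T -> r \in T -> s \in T ->
  same_coset c s r -> exists2 k, k < N.*2.+1 & s = r * c ^- N * c ^+ k.
Proof.
move=> bd rT sT /(bd _ _ sT rT)[i [j [iN jN e]]].
(* The exponent j - i ranges over [-N, N]; starting at [r * c ^- N] makes it nonnegative and
   explains the length 2N + 1. *)
exists (N + j - i).
  by rewrite ltnS -addnn (leq_trans (leq_subr _ _)) // leq_add2l.
rewrite expgnFr ?(leq_trans iN) ?leq_addr // expgnDr !mulgA mulgVK -e.
by rewrite mulgK.
Qed.

(** Computable from coset membership alone: it mentions neither the order of [c] nor any
    exponent. *)
Definition coset_list_prod c r L : A :=
  \prod_(p <- L | `[< same_coset c p.1 r >]) p.2.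

Hypothesis abA : is_abelian A.

Lemma coset_prodM F G r c n :
  coset_prod (fun s => F s * G s) r c n = coset_prod F r c n * coset_prod G r c n.
Proof.
elim: n => [|n IH]; first by rewrite /= mulg1.
rewrite !coset_prodS IH -!mulgA; congr (_ * _).
by rewrite !mulgA; congr (_ * _); exact: abA.
Qed.

Lemma coset_prod_point u (a : A) r c n :
  (forall i j, i < n -> j < n -> r * c ^+ i = r * c ^+ j -> i = j) ->
  coset_prod (fun s => if u == s then a else 1) r c n =
  if `[< exists2 k, k < n & u = r * c ^+ k >] then a else 1.
Proof.
elim: n => [|n IH] inj; first by rewrite asboolF // => -[].
rewrite coset_prodS IH => [|i j /ltnW ni /ltnW nj]; last exact: inj.
case: eqP => [->|ne].
  rewrite asboolF ?asboolT ?mul1g //; first by exists n.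
  move=> [k kn] /inj e; have := e (ltnSn n) (ltnW kn).
  by move=> kk; move: kn; rewrite -kk ltnn.
rewrite mulg1; congr (if _ then _ else _); apply/asbool_equiv_eq; split=> -[k].
  by move=> kn ->; exists k => //; exact: ltnW.
rewrite ltnS leq_eqVlt => /orP[/eqP->//|kn e]; by exists k.
Qed.

Lemma coset_prod_list c r n L :
  (forall i j, i < n -> j < n -> r * c ^+ i = r * c ^+ j -> i = j) ->
  coset_prod (list_fun L) r c n =
  \prod_(p <- L | `[< exists2 k, k < n & p.1 = r * c ^+ k >]) p.2.
Proof.
move=> inj; elim: L => [|p L IH].
  rewrite big_nil; elim: n {inj} => // n IH.
  by rewrite coset_prodS IH /list_fun big_nil mulg1.
have -> : list_fun (p :: L) = fun s => (if p.1 == s then p.2 else 1) * list_fun L s.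
  by apply: funext => s; rewrite list_fun_cons.
rewrite coset_prodM IH coset_prod_point // big_cons.
by case: asboolP => // _; rewrite mul1g.
Qed.

Lemma cohomologous_at_coset c r t F G :
  same_coset c r t -> cohomologous_at c r F G -> cohomologous_at c t F G.
Proof.
move=> rt [h eh]; exists h => s st; apply: eh.
exact: (same_coset_trans st (same_coset_sym rt)).
Qed.

Lemma in_window_list c N T r L : coset_bound c N T -> r \in T ->
  {subset map fst L <= T} -> in_window c (r * c ^- N) N.*2.+1 (list_fun L).
Proof.
move=> bd rT LT s sr /list_fun_supp/LT sT; apply: coset_bound_window bd rT sT _.
exact: same_coset_trans sr (same_coset_mulVX _ _ _).
Qed.

(** The window is the whole coset if [c] has finite order, and otherwise long enough for all listed
    points. Either way each listed point of the coset is met exactly once, so the ordered product is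
    a rearrangement of [coset_list_prod]. *)
Lemma cohomologous_at_abelian c r L M :
  cohomologous_at c r (list_fun L) (list_fun M) <->
  coset_list_prod c r L = coset_list_prod c r M.
Proof.
have [fin|inf] := pselect (finite_order c).
  have [n [n0 cn cmin]] := finite_order_min fin.
  have e K : coset_prod (list_fun K) r c n = coset_list_prod c r K.
    rewrite coset_prod_list; last exact: orderX_inj.
    apply: eq_bigl => p; apply/asbool_equiv_eq; split=> [[k _ ->]|].
      exact: same_coset_mulX.
    by move/(same_coset_window n0 cn).
  rewrite (cohomologous_at_finite _ _ _ n0 cn cmin) !e; split=> [[z ->]|->].
    by rewrite conjgE abA mulgK.
  by exists 1; rewrite conjg1.
have [N bd] := coset_bound_ex c (r :: map fst (L ++ M)).
pose r' := r * c ^- N; have r'r := same_coset_mulVX c r N.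
have rT := mem_head r (map fst (L ++ M)).
have LT : {subset map fst L <= r :: map fst (L ++ M)}.
  by move=> s sL; rewrite inE map_cat mem_cat sL orbT.
have MT : {subset map fst M <= r :: map fst (L ++ M)}.
  by move=> s sL; rewrite inE map_cat mem_cat sL !orbT.
have e K : {subset map fst K <= r :: map fst (L ++ M)} ->
    coset_prod (list_fun K) r' c N.*2.+1 = coset_list_prod c r K.
  move=> KT; rewrite coset_prod_list => [|i j _ _]; last exact: infinite_orderX_inj.
  rewrite /coset_list_prod big_seq_cond [RHS]big_seq_cond.
  apply: eq_bigl => p; case pK: (p \in K) => //=; apply/asbool_equiv_eq.
  split=> [[k _ ->]|].
    exact: same_coset_trans (same_coset_mulX _ _ _) r'r.
  by apply: (coset_bound_window bd rT); apply/KT/map_f.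
rewrite -!e // -(cohomologous_at_infinite inf); try exact: in_window_list bd rT _.
split; apply: cohomologous_at_coset => //; exact: same_coset_sym.
Qed.

End ListFunctions.

(** * Test elements for the power and order problems *)

Section ConjugacyChain.
Variable G : groupType.
Implicit Types x a : G.
Local Open Scope group_scope.

(* Conjugating by [a ^ (x ^+ k)] turns the statement for [k] into the one for
   [k.+1]. *)
Lemma conj_chain x a k : (forall j, commute (a ^ (x ^+ j)) a) ->
  exists z, x * a * (a^-1) ^ (x ^+ k) = x ^ z.
Proof.
move=> comm; elim: k => [|k [z ez]]; first by exists 1; rewrite !conjg1 mulgK.
exists (z * a ^ (x ^+ k)); rewrite conjgM -ez !conjVg [RHS]conjgE mulgVK.
have := comm k.+1; rewrite expgSr conjgM; set u := a ^ _ => cu.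
rewrite mulgA [u^-1 * x]conjgC conjVg -!mulgA; congr (_ * _).
by apply: commuteV; apply/commute_sym.
Qed.

Lemma conj_chain_zexpg x a (n : int) :
  (forall j, commute (a ^ (x ^+ j)) a) ->
  exists z, x * a * (a^-1) ^ (zexpg x n) = x ^ z.
Proof.
case: n => k /= comm; first exact: conj_chain.
have commV j : commute (a^-1 ^ (x ^+ j)) a^-1.
  by rewrite conjVg; apply/commuteV/commute_sym/commuteV/commute_sym.
(* For a negative exponent the chain is run with a^-1 and gives x a^-1 a^(x^(k+1)). Conjugation by
   x^-(k+1) fixes x and moves the factors to (a^-1)^(x^-(k+1)) and a, which commute. *)
have [z ez] := conj_chain k.+1 commV.
exists (z * x ^- k.+1); rewrite conjgM -ez invgK conjMg -conjgM mulgV conjg1.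
rewrite [(x * _) ^ _]conjMg.
have -> : x ^ (x ^- k.+1) = x by apply/conjg_fixP; rewrite commgXVg.
rewrite -[LHS]mulgA -[RHS]mulgA; congr (_ * _).
have := congr1 (conjg^~ (x ^- k.+1)) (comm k.+1).
rewrite /= [LHS]conjMg [RHS]conjMg -!conjgM mulgV conjg1 => e.
by rewrite !conjVg; apply: commuteV.
Qed.

End ConjugacyChain.

Section WreathElements.
Variables A B : groupType.
Local Notation W := (wreath A B).
Local Open Scope group_scope.

Definition base_elt (b : B) : W := Wreath b (fun_one A B).
Definition point_elt (a : A) : W := Wreath 1 [fsfun fun_one A B with 1 |-> a].

Lemma base_eltE b s : wreath_fun (base_elt b) s = 1.
Proof. by rewrite fsfun0E. Qed.

Lemma point_eltE a s : wreath_fun (point_elt a) s = if s == 1 then a else 1.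
Proof. by rewrite fsfun_withE fsfun0E. Qed.

Lemma base_eltM b c : base_elt (b * c) = base_elt b * base_elt c.
Proof.
by apply: wreathP => // s; rewrite wreath_funM !base_eltE mulg1.
Qed.

Lemma base_elt1 : base_elt 1 = 1.
Proof. by apply: wreathP => // s; rewrite base_eltE wreath_fun1. Qed.

Lemma base_eltX b n : base_elt (b ^+ n) = base_elt b ^+ n.
Proof. by elim: n => [|n IH]; rewrite ?base_elt1 // !expgS base_eltM IH. Qed.

Lemma base_eltV b : base_elt b^-1 = (base_elt b)^-1.
Proof. by apply/esym/mulg1_eq; rewrite -base_eltM mulgV base_elt1. Qed.

Lemma base_eltZ b n : base_elt (zexpg b n) = zexpg (base_elt b) n.
Proof. by case: n => k /=; rewrite ?base_eltV base_eltX. Qed.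

Lemma point_eltM a b : point_elt (a * b) = point_elt a * point_elt b.
Proof.
apply: wreathP => [|s]; first by rewrite /= mulg1.
rewrite wreath_funM !point_eltE /= invg1 mulg1.
by case: eqP; rewrite ?mulg1.
Qed.

Lemma point_elt1 : point_elt 1 = 1.
Proof.
by apply: wreathP => // s; rewrite point_eltE wreath_fun1; case: eqP.
Qed.

Lemma point_eltV a : point_elt a^-1 = (point_elt a)^-1.
Proof. by apply/esym/mulg1_eq; rewrite -point_eltM mulgV point_elt1. Qed.

Lemma point_conjE a y s :
  wreath_fun (point_elt a ^ base_elt y) s = if s == y then a else 1.
Proof.
rewrite conjgE !wreath_funM wreath_funV point_eltE !base_eltE /=.
by rewrite invg1 mul1g mulg1 (can2_eq (mulgVK y) (mulgK y)) mul1g.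
Qed.

Lemma point_conj_base a y : wreath_base (point_elt a ^ base_elt y) = 1.
Proof. by rewrite conjgE /= mul1g mulVg. Qed.

Lemma coset_prod_head (F : B -> A) r c n : 0 < n ->
  (forall k, 0 < k < n -> F (r * c ^+ k) = 1) -> coset_prod F r c n = F r.
Proof.
case: n => // n _; elim: n => [|n IH] F1.
  by rewrite coset_prodS /= mul1g mulg1.
by rewrite coset_prodS F1 ?ltnSn // mulg1 IH // => k /andP[k0 kn];
  rewrite F1 // k0 ltnW.
Qed.

Lemma coset_prod1 (F : B -> A) r c : coset_prod F r c 1 = F r.
Proof. by rewrite coset_prodS /= mul1g mulg1. Qed.

(** For y = x^n the chain applies, because [point_elt a] commutes with its conjugates by powers of
    [base_elt x]. Otherwise the only nontrivial value on the coset <x> is a at 1, so the coset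
    product is a, which is neither equal nor conjugate to 1. *)
Lemma wreath_power_criterion (x y : B) (a : A) : a <> 1 ->
  (exists z, base_elt x * point_elt a * (point_elt a)^-1 ^ base_elt y =
     base_elt x ^ z) <-> exists n : int, y = zexpg x n.
Proof.
move=> a1; split=> [|[n ->]]; last first.
  rewrite base_eltZ; apply: conj_chain_zexpg => j; rewrite -base_eltX.
  apply: wreathP => [|s].
    by rewrite [LHS]wreath_baseM [RHS]wreath_baseM point_conj_base.
  rewrite [LHS]wreath_funM [RHS]wreath_funM point_conjE point_eltE.
  rewrite point_conj_base invg1 !mulg1 point_conjE point_eltE.
  by do 2 case: eqP => // _; rewrite ?mulg1 ?mul1g.
pose g s := (if s == 1 then a else 1) * (if s == y then a^-1 else 1).
set w := _ * _.
have wg s : wreath_fun w s = g s.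
  rewrite /w wreath_funM -point_eltV point_conjE point_conj_base invg1 mulg1.
  by rewrite wreath_funM base_eltE mul1g point_eltE.
have wb : wreath_base w = x.
  by rewrite /w wreath_baseM -point_eltV point_conj_base mulg1 /= mulg1.
(* Here [base_elt x] takes the place of [y] or of [x] with an empty support list, so only the second
   alternative survives. *)
case/(@wreath_conjP _ _ _ _ [::] [:: 1; y]) => [s|s||[_ _]].
- by rewrite base_eltE.
- rewrite wg /g !inE; case: eqP => // _; case: eqP => // _.
  by rewrite mulg1.
- by case.
rewrite wb => -[h eh]; apply/same_coset1; apply: contrapT => ny.
have nyx k : x ^+ k <> y.
  by move=> e; apply: ny; rewrite -e -[x ^+ k]mul1g; exact: same_coset_mulX.
have g1 : g 1 = a.
  rewrite /g eqxx; case: eqP => [e|_]; last by rewrite mulg1.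
  by case: (nyx 0); rewrite -e.
have gk k : g (1 * x ^+ k) = if x ^+ k == 1 then a else 1.
  by rewrite mul1g /g; case: (x ^+ k =P y) => [/nyx//|_]; rewrite mulg1.
have coh : cohomologous_at x 1 (fun=> 1) g.
  by exists h => s _; rewrite eh wg.
have [fin|inf] := pselect (finite_order x).
  have [n [n0 xn xmin]] := finite_order_min fin.
  move/(cohomologous_at_finite _ _ _ n0 xn xmin): coh => -[z].
  rewrite !coset_prod_head // ?g1 ?conj1g // => k /xmin xk.
  by rewrite gk; case: eqP.
have win : in_window x 1 1 g.
  move=> s; rewrite /g; case: eqP => [-> _ _|_]; first by exists 0; rewrite ?mulg1.
  by case: eqP => [->//|_]; rewrite mulg1.
have win1 : in_window x 1 1 (fun=> 1 : A) by move=> s _ [].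
have := coh; rewrite (cohomologous_at_infinite inf win1 win).
by rewrite !coset_prod1 g1 => /esym.
Qed.

(** All nontrivial values sit at 1, so the products over <x> are ab and ba: conjugate by a, but
    distinct. The second alternative of [wreath_conjP] would, for infinite order, force ab = 1, and
    then a and b commute. *)
Lemma wreath_order_criterion (x : B) (a b : A) : ~ commute a b ->
  (exists z, base_elt x * point_elt (b * a) = (base_elt x * point_elt (a * b)) ^ z)
  <-> finite_order x.
Proof.
move=> nab.
have wb u : wreath_base (base_elt x * point_elt u) = x by rewrite /= mulg1.
have wf u s : wreath_fun (base_elt x * point_elt u) s = if s == 1 then u else 1.
  by rewrite wreath_funM base_eltE mul1g point_eltE.
have supp u s : wreath_fun (base_elt x * point_elt u) s <> 1 -> s \in [:: 1].
  by rewrite wf inE; case: eqP.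
have local u v : (forall s,
    wreath_fun (base_elt x * point_elt u) s <> 1 \/
    wreath_fun (base_elt x * point_elt v) s <> 1 ->
    exists2 t, t \in [:: 1] & same_coset x s t).
  by move=> s [] /supp; rewrite inE => /eqP->; exists 1; rewrite ?inE //;
    exact: same_coset_refl.
have win u : in_window x 1 1 (wreath_fun (base_elt x * point_elt u)).
  by move=> s _ /supp; rewrite inE => /eqP->; exists 0; rewrite ?mulg1.
split=> [|fin].
  move=> conj; apply: contrapT => inf; move: conj.
  case/(wreath_conjP (supp _) (supp _)) => [|[_ cx _]].
    case=> t; rewrite inE => /eqP-> [s]; rewrite inE => /eqP->; rewrite !wb => -[_].
    have -> : (fun u => wreath_fun (base_elt x * point_elt (a * b))
        (u * (1^-1 * 1)^-1)) = wreath_fun (base_elt x * point_elt (a * b)).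
      by apply: funext => u; rewrite invg1 mulg1 invg1 mulg1.
    case=> h eh; have coh : cohomologous_at x 1
        (wreath_fun (base_elt x * point_elt (a * b)))
        (wreath_fun (base_elt x * point_elt (b * a))).
      by exists h => ? _; exact: eh.
    move/(cohomologous_at_infinite inf (win _) (win _)): coh.
    by rewrite !coset_prod1 !wf eqxx => /nab.
  move: cx; rewrite wb => -[h eh]; have coh : cohomologous_at x 1
      (wreath_fun (base_elt x * point_elt (a * b))) (fun=> 1).
    by exists h => ? _; exact: eh.
  have win1 : in_window x 1 1 (fun=> 1 : A) by move=> s _ [].
  move/(cohomologous_at_infinite inf (win _) win1): coh.
  rewrite !coset_prod1 wf eqxx => ab1; apply: nab.
  by rewrite /commute ab1 -(mulg1_eq ab1) mulVg.
have [n [n0 xn xmin]] := finite_order_min fin.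
apply: (@conj_ofbase _ _ _ _ 1); rewrite ?wb ?mulg1 ?mul1g //.
have -> : (fun u => wreath_fun (base_elt x * point_elt (a * b))
    (u * 1^-1)) = wreath_fun (base_elt x * point_elt (a * b)).
  by apply: funext => u; rewrite invg1 mulg1.
apply/(cohomologousP (local _ _)) => t; rewrite inE => /eqP->.
apply/(cohomologous_at_finite _ _ _ n0 xn xmin); exists a.
rewrite !coset_prod_head // ?wf ?eqxx.
- by rewrite conjgE !mulgA mulVg mul1g.
- by move=> k /xmin; rewrite mul1g wf; case: eqP.
by move=> k /xmin; rewrite mul1g wf; case: eqP.
Qed.

End WreathElements.

(** * Words and decision problems *)

(** One composition rule for each head of the body; goals about evaluated words or about unlisted
    functions are left to the caller. *)
Ltac computability_step :=
  match goal with
  | |- computable (fun x => x) => apply: computable_id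
  | |- computable (fun _ => ?c) => apply: computable_const
  | H : computable ?f |- computable ?f => exact: H
  | H : computable ?f |- computable (fun x => ?f _) => apply: (computable_comp H)
  | |- computable fst => exact: computable_fst computable_id
  | |- computable snd => exact: computable_snd computable_id
  | |- computable (fun x => (_).1) => apply: computable_fst
  | |- computable (fun x => (_).2) => apply: computable_snd
  | |- computable (fun x => (_, _)) => apply: computable_pair
  | |- computable (fun x => _ :: _) => apply: computable_cons
  | |- computable (fun x => _ ++ _) => apply: computable_cat
  | |- computable (fun x => map (_) (_)) => apply: computable_map
  | |- computable (map ?f) => apply: (computable_map (f := fun=> f))
  | |- computable (filter ?f) => apply: (computable_filter (p := fun=> f))
  | |- computable (fun x => filter (_) (_)) => apply: computable_filter
  | |- computable (fun x => flatten (_)) => apply: computable_flatten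
  | |- computable (fun x => rev (_)) => apply: computable_rev
  | |- computable (fun x => iota 0 (_)) => apply: computable_iota
  | |- computable (fun x => nat_of_bool (all (_) (_))) =>
      apply: computable_all
  | |- computable (fun x => nat_of_bool (has (_) (_))) =>
      apply: computable_has
  | |- computable (fun x => nat_of_bool (_ && _)) => apply: computable_and
  | |- computable (fun x => nat_of_bool (_ || _)) => apply: computable_or
  | |- computable (fun x => nat_of_bool (~~ _)) => apply: computable_not
  | |- computable (fun x => nat_of_bool (odd (_))) => apply: computable_odd
  | |- computable (fun x => nat_of_bool (_ <= _)) => apply: computable_leq
  | |- computable (fun x => nat_of_bool (_ == 0)) => apply: computable_eq0
  | |- computable (fun x => if _ then _ else _) => apply: computable_if
  | |- computable (fun x => (_).+1) => apply: computable_succ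
  | |- computable (fun x => (_).-1) => apply: computable_pred
  | |- computable (fun x => _ - _) => apply: computable_subn
  end.

Ltac computability := cbv beta; repeat (computability_step; cbv beta).

Section RawWords.
Variables (G : groupType) (m : nat) (g : 'I_m -> G).
Implicit Types (s t : seq nat) (w : word m).
Local Open Scope group_scope.

(* Words are handled through their letter codes; a code outside the range of the
   generators denotes the identity, so that every [seq nat] has a value. *)
Definition raw_word w : seq nat :=
  [seq (nat_of_ord l.1).*2 + l.2 | l : 'I_m * bool <- w]%N.

Definition letter_eval k : G :=
  if insub k./2 is Some i then if odd k then (g i)^-1 else g i else 1.

Definition raw_eval s : G := \prod_(k <- s) letter_eval k.

Definition word_of_raw s : word m :=
  pmap (fun k => omap (fun i => (i, odd k)) (insub k./2)) s.

Lemma word_codeE w : word_code w = enc (raw_word w).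
Proof. by rewrite /word_code /enc /= /seq_enc map_id. Qed.

Lemma raw_eval_cat s t : raw_eval (s ++ t) = raw_eval s * raw_eval t.
Proof. by rewrite /raw_eval big_cat. Qed.

Lemma raw_eval_nil : raw_eval [::] = 1.
Proof. by rewrite /raw_eval big_nil. Qed.

Lemma raw_eval_cons k s : raw_eval (k :: s) = letter_eval k * raw_eval s.
Proof. by rewrite /raw_eval big_cons. Qed.

Lemma raw_eval_raw w : raw_eval (raw_word w) = word_eval g w.
Proof.
rewrite /raw_eval /word_eval big_map; apply: eq_bigr => -[i b] _ /=.
rewrite /letter_eval oddD odd_double oddb addnC half_bit_double /=.
by case: insubP => [j _ /val_inj ->|]; rewrite ?ltn_ord.
Qed.

Lemma raw_word_of_raw s : raw_word (word_of_raw s) = [seq k <- s | k < m.*2].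
Proof.
elim: s => //= k s IH; rewrite /word_of_raw /=.
have -> : (k < m.*2) = (k./2 < m) by rewrite ltn_half_double.
case: insubP => [i ik ei|/negPf->] //=.
by rewrite ik /= -/(word_of_raw s) IH ei addnC odd_double_half.
Qed.

Lemma letter_eval_default k : m.*2 <= k -> letter_eval k = 1.
Proof. by move=> mk; rewrite /letter_eval insubF // ltn_half_double ltnNge mk. Qed.

Lemma raw_eval_filter s : raw_eval [seq k <- s | k < m.*2] = raw_eval s.
Proof.
elim: s => //= k s IH; case: ltnP => mk; rewrite !raw_eval_cons IH //.
by rewrite letter_eval_default // mul1g.
Qed.

Lemma word_eval_of_raw s : word_eval g (word_of_raw s) = raw_eval s.
Proof. by rewrite -raw_eval_raw raw_word_of_raw raw_eval_filter. Qed.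

Definition raw_inv s : seq nat :=
  rev (map (fun k => if odd k then k.-1 else k.+1) s).

Lemma raw_eval_inv s : raw_eval (raw_inv s) = (raw_eval s)^-1.
Proof.
elim: s => [|k s IH]; first by rewrite raw_eval_nil invg1.
rewrite /raw_inv /= rev_cons -cats1 raw_eval_cat -/(raw_inv s) IH !raw_eval_cons.
rewrite raw_eval_nil mulg1 invgM; congr (_ * _).
rewrite /letter_eval; case ok: (odd k).
  case: k ok => // k /= /negPf ok; rewrite ok uphalf_half ok /=.
  by case: insub => *; rewrite ?invgK ?invg1.
by rewrite /= uphalf_half ok; case: insub => *; rewrite ?invg1.
Qed.

Lemma computable_raw_inv : computable raw_inv.
Proof. by rewrite /raw_inv; computability. Qed.

End RawWords.

Section DecidableWords.
Variable m : nat.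

Lemma recursive_tuple1 {X : Type} {cX : coded X} (f : 1.-tuple nat -> nat)
    (h : X -> nat) :
  recursive f -> computable h -> computable (fun x => f [tuple h x]).
Proof.
move=> rf ch; apply: rec_ext (rec_comp rf (fun=> ch)) => v.
by congr f; apply: eq_from_tnth => i; rewrite tnth_mktuple ord1.
Qed.

Lemma recursive_tuple2 {X : Type} {cX : coded X} (f : 2.-tuple nat -> nat)
    (h k : X -> nat) :
  recursive f -> computable h -> computable k ->
  computable (fun x => f [tuple h x; k x]).
Proof.
move=> rf ch ck.
have rk (i : 'I_2) : computable (if i == ord0 then h else k) by case: ifP.
apply: rec_ext (rec_comp rf rk) => v.
congr f; apply: eq_from_tnth => i; rewrite tnth_mktuple.
case: (unliftP ord0 i) => [j ->|->] //; rewrite ord1 /=.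
by [].
Qed.

Lemma computable_word_code :
  computable (fun s : seq nat => word_code (word_of_raw m s)).
Proof.
apply: (@computable_ext _ _ _ _ (fun s => enc [seq k <- s | k < m.*2])).
  by move=> s; rewrite word_codeE raw_word_of_raw.
by apply/computable_enc; computability.
Qed.

(** The function deciding [P] is reliable only at codes of words; passing through [word_of_raw]
    extends it to every list. The brackets denote the classical truth value, so decidability is the
    computability of this 0/1-valued function. *)
Lemma computable_decidable1 (P : word m -> Prop) : decidable_words1 P ->
  computable (fun s : seq nat => `[< P (word_of_raw m s) >] : nat).
Proof.
case=> f rf fP; apply: (@computable_ext _ _ _ _
  (fun s => f [tuple word_code (word_of_raw m s)] == 1 : nat)) => [s|].
  by congr nat_of_bool; apply/eqP/asboolP => /fP.
apply: computable_eqn (computable_const _).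
exact: recursive_tuple1 rf computable_word_code.
Qed.

Lemma computable_decidable2 (P : word m -> word m -> Prop) : decidable_words2 P ->
  computable (fun p : seq nat * seq nat =>
    `[< P (word_of_raw m p.1) (word_of_raw m p.2) >] : nat).
Proof.
case=> f rf fP; apply: (@computable_ext _ _ _ _ (fun p : seq nat * seq nat =>
  f [tuple word_code (word_of_raw m p.1); word_code (word_of_raw m p.2)]
    == 1 : nat)) => [p|].
  by congr nat_of_bool; apply/eqP/asboolP => /fP.
apply: computable_eqn (computable_const _).
apply: recursive_tuple2 rf _ _; apply: (computable_comp computable_word_code);
  computability.
Qed.

Lemma decidable_computable1 (P : word m -> Prop) (b : seq nat -> bool) :
  computable (fun s => b s : nat) -> (forall w, P w <-> b (raw_word w)) ->
  decidable_words1 P.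
Proof.
move=> cb bP; exists (fun v => b (dec (thead v)) : nat); first exact: cb.
by move=> w; rewrite bP word_codeE /thead tnth0 encK; case: (b _).
Qed.

Lemma decidable_computable2 (P : word m -> word m -> Prop)
    (b : seq nat * seq nat -> bool) :
  computable (fun p => b p : nat) ->
  (forall u v, P u v <-> b (raw_word u, raw_word v)) -> decidable_words2 P.
Proof.
move=> cb bP; exists (fun v : 2.-tuple nat =>
  b (dec (thead v), dec (thead [tuple of behead v])) : nat); last first.
  by move=> u v; rewrite bP !word_codeE /thead !tnth0 !encK; case: (b _).
have rp : recursive (fun v : 2.-tuple nat =>
    pair_code (thead v, thead [tuple of behead v])).
  apply: recursive_pair_code; first exact: rec_proj.
  exact: (@recursive_behead 1 _ (rec_proj ord0)).
apply: rec_ext (@recursive_apply1 2 (fun m => b (dec m)) _ cb rp) => v.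
by rewrite /dec /= /prod_dec pair_codeK.
Qed.

End DecidableWords.

(** Only the letter codes below [m.*2] need images. They form a finite table, so choosing them
    ineffectively still gives a computable map; every other code evaluates to 1 and is sent to the
    empty word. *)
Lemma raw_eval_translate (G H : groupType) (m n : nat) (g : 'I_m -> G)
    (h : 'I_n -> H) (phi : G -> H) :
  phi 1%g = 1%g -> {morph phi : x y / (x * y)%g} ->
  (forall x, exists s, raw_eval h s = x) ->
  exists2 f : seq nat -> seq nat, computable f &
    forall s, raw_eval h (f s) = phi (raw_eval g s).
Proof.
move=> phi1 phiM surj.
have [t tP] := boolp.choice (fun k => surj (phi (letter_eval g k))).
exists (fun s => flatten (map (nth [::] (mkseq t m.*2)) s)).
  apply: computable_flatten; apply: (computable_map (f := fun _ => nth [::] _)).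
    by apply: computable_nth; computability.
  exact: computable_id.
elim=> [|k s IH]; first by rewrite !raw_eval_nil.
rewrite /= raw_eval_cat raw_eval_cons phiM IH; congr (_ * _)%g.
have [km|mk] := ltnP k m.*2; first by rewrite nth_mkseq.
by rewrite nth_default ?size_mkseq // letter_eval_default // raw_eval_nil.
Qed.

Section ConjugacyPresentation.
Variables (G : groupType) (m : nat) (g : 'I_m -> G).
Local Open Scope group_scope.

Definition computable_conj : Prop :=
  computable (fun p : seq nat * seq nat =>
    `[< exists z, raw_eval g p.2 = raw_eval g p.1 ^ z >] : nat).

Hypothesis conjG : computable_conj.

Lemma computable_trivial :
  computable (fun s : seq nat => raw_eval g s == 1 : nat).
Proof.
apply: (@computable_ext _ _ _ _ (fun s =>
  `[< exists z, raw_eval g s = raw_eval g [::] ^ z >] : nat)) => [s|].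
  congr nat_of_bool; rewrite raw_eval_nil.
  by apply/asboolP/eqP => [[z ->]|->]; [rewrite conj1g|exists 1; rewrite conj1g].
apply: (computable_comp2 (F := fun t s =>
  `[< exists z, raw_eval g s = raw_eval g t ^ z >] : nat)) => //; computability.
Qed.

Lemma computable_raw_eq {X : Type} {cX : coded X} (s t : X -> seq nat) :
  computable s -> computable t ->
  computable (fun x => raw_eval g (s x) == raw_eval g (t x) : nat).
Proof.
move=> cs ct; apply: (@computable_ext _ _ _ _ (fun x =>
  raw_eval g (s x ++ raw_inv (t x)) == 1 : nat)) => [x|].
  by rewrite raw_eval_cat raw_eval_inv divg_eq mul1g.
apply: (computable_comp computable_trivial).
by apply: computable_cat cs _; exact: computable_comp computable_raw_inv ct.
Qed.

Lemma raw_eval_surj : (forall x, exists w, word_eval g w = x) ->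
  forall x, exists s, raw_eval g s = x.
Proof.
by move=> h x; have [w <-] := h x; exists (raw_word w); rewrite raw_eval_raw.
Qed.

Lemma word_eval_cat u v : word_eval g (u ++ v) = word_eval g u * word_eval g v.
Proof. by rewrite /word_eval big_cat. Qed.

Definition word_inv (w : word m) : word m := rev (map (fun l => (l.1, ~~ l.2)) w).

Lemma word_eval_inv w : word_eval g (word_inv w) = (word_eval g w)^-1.
Proof.
elim: w => [|[i b] w IH]; first by rewrite /word_eval big_nil invg1.
rewrite /word_inv /= rev_cons -cats1 word_eval_cat -/(word_inv w) IH.
rewrite /word_eval big_seq1 big_cons invgM /=.
by case: b; rewrite ?invgK.
Qed.

Lemma presented_eq_inv (R : word m -> Prop) u v :
  presented_eq R (u ++ word_inv v ++ v) u.
Proof.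
elim: v u => [|[i b] v IH] u; first by rewrite /= cats0; exact: presented_refl.
rewrite /word_inv /= rev_cons -cats1 -catA -/(word_inv v).
have := presented_cancel R (u ++ word_inv v) v i (~~ b); rewrite negbK -!catA /=.
by move/presented_trans; apply; exact: IH.
Qed.

(** With every trivial word as a relator, u v^-1 can be deleted from u v^-1 v, and the latter
    reduces to u by cancellation. *)
Lemma presented_eq_trivial u v :
  word_eval g u = word_eval g v <->
  presented_eq (fun w => word_eval g w = 1) u v.
Proof.
split=> [e|].
  apply: presented_trans (presented_sym (presented_eq_inv _ u v)) _.
  rewrite catA -[X in presented_eq _ X _]cat0s.
  apply: (presented_relator [::] v).
  by rewrite word_eval_cat word_eval_inv e mulgV.
elim=> {u v} [||u v w _ -> _ ->||u v r r1] //.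
  move=> u v i b; rewrite !word_eval_cat; congr (_ * _).
  rewrite [X in X * _](_ : _ = 1) ?mul1g //.
  by rewrite /word_eval !big_cons big_nil mulg1; case: b; rewrite /= ?mulgV ?mulVg.
by rewrite !word_eval_cat r1 mul1g.
Qed.

Lemma trivial_words_re :
  recursively_enumerable (fun x => exists2 w : word m, word_eval g w = 1 &
    word_code w = x).
Proof.
right.
(* The enumeration returns [k] itself when it codes a trivial word, and otherwise 0, the code of the
   empty word. *)
have cf : computable (fun k => if all (fun j => j < m.*2)%N (dec k : seq nat)
    && (raw_eval g (dec k) == 1) then k else 0).
  have cd : computable (dec : nat -> seq nat).
    exact/computable_dec/computable_id.
  apply: computable_if; try computability.
  exact: computable_comp computable_trivial cd.
exists (fun v => if all (fun j => j < m.*2)%N (dec (thead v) : seq nat)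
    && (raw_eval g (dec (thead v)) == 1) then thead v else 0).
  exact: cf.
move=> x; rewrite /thead; split=> [[w w1 <-]|[k <-]].
  exists (word_code w); rewrite tnth0 word_codeE encK raw_eval_raw w1 eqxx andbT.
  rewrite ifT //; apply/allP => _ /mapP[[i b] _ ->] /=.
  rewrite -ltn_half_double addnC half_bit_double; exact: ltn_ord.
rewrite tnth0; case: ifP => [/andP[lt /eqP e]|_]; last first.
  by exists [::]; rewrite // /word_eval big_nil.
exists (word_of_raw m (dec k)); first by rewrite word_eval_of_raw.
by rewrite word_codeE raw_word_of_raw (all_filterP lt) decK.
Qed.

Lemma class_C_of_conj : (forall x, exists w, word_eval g w = x) -> class_C G.
Proof.
move=> surj.
exists (RecursivePresentation surj presented_eq_trivial trivial_words_re).
apply: (decidable_computable2 (b := fun p : seq nat * seq nat =>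
  `[< exists z, raw_eval g p.2 = raw_eval g p.1 ^ z >])) => // u v /=.
rewrite !raw_eval_raw.
by split=> /asboolP.
Qed.

End ConjugacyPresentation.

Lemma computable_conj_of (G : groupType) (P : recursive_presentation G) :
  solvable_conjugacy_problem P -> computable_conj (@gens _ P).
Proof.
move=> /computable_decidable2; apply: computable_ext => p.
by rewrite !word_eval_of_raw.
Qed.

(** * The power and order problems from conjugacy in the wreath product *)

Section Necessity.
Variables (A B : groupType) (PB : recursive_presentation B).
Hypotheses (ntA : nontrivial A) (cW : class_C (wreath A B)).
Local Open Scope group_scope.
Local Notation evalB := (raw_eval (@gens _ PB)).

Lemma wreath_base_words : exists (n : nat) (g : 'I_n -> wreath A B),
  [/\ computable_conj g, forall x, exists s, raw_eval g s = x &
    exists2 f : seq nat -> seq nat, computable f &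
      forall s, raw_eval g (f s) = base_elt A (evalB s)].
Proof.
have [P /computable_conj_of cP] := cW; exists (generator_count P), (@gens _ P).
have surj := raw_eval_surj (@gens_generate _ P).
split=> //.
by apply: raw_eval_translate => //; exact: base_eltM.
Qed.

Lemma power_problem_of_wreath : solvable_power_problem PB.
Proof.
have [n [g [cg surj [f cf fP]]]] := wreath_base_words.
have [a a1] := ntA; have [wa ea] := surj (point_elt B a).
(* This word spells x a (a^-1)^y, the left-hand side of [wreath_power_criterion]. *)
pose v (p : seq nat * seq nat) :=
  f p.1 ++ wa ++ raw_inv (f p.2) ++ raw_inv wa ++ f p.2.
have cf1 : computable (fun p : seq nat * seq nat => f p.1).
  by apply: (computable_comp cf); computability.
have cf2 : computable (fun p : seq nat * seq nat => f p.2).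
  by apply: (computable_comp cf); computability.
have cv : computable v.
  have cf2V := computable_comp computable_raw_inv cf2.
  by rewrite /v; computability.
apply: (@decidable_computable2 _ _ (fun p =>
  `[< exists z, raw_eval g (v p) = raw_eval g (f p.1) ^ z >])).
  exact: (computable_comp2 (F := fun s t =>
    `[< exists z, raw_eval g t = raw_eval g s ^ z >] : nat)) cg cf1 cv.
move=> s t; rewrite -!raw_eval_raw -(wreath_power_criterion _ _ a1).
rewrite /v /= !raw_eval_cat !raw_eval_inv !fP ea [in X in _ <-> X]mulgA.
by split=> [e|/asboolP //]; apply/asboolP.
Qed.

Lemma order_problem_of_wreath : ~ is_abelian A -> solvable_order_problem PB.
Proof.
move=> nab; have [a [b ab]] : exists a b : A, ~ commute a b.
  apply: contrapT => h; apply: nab => a b; apply: contrapT => ab; apply: h.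
  by exists a, b.
have [n [g [cg surj [f cf fP]]]] := wreath_base_words.
have [u eu] := surj (point_elt B (a * b)).
have [v ev] := surj (point_elt B (b * a)).
apply: (@decidable_computable1 _ _ (fun s =>
  `[< exists z, raw_eval g (f s ++ v) = raw_eval g (f s ++ u) ^ z >])).
  apply: (computable_comp2 (F := fun s t =>
    `[< exists z, raw_eval g t = raw_eval g s ^ z >] : nat)) cg _ _; computability.
move=> s; rewrite -!raw_eval_raw -(wreath_order_criterion _ ab).
rewrite !raw_eval_cat !fP eu ev.
by split=> [e|/asboolP] //; apply/asboolP.
Qed.

End Necessity.

(** * Deciding conjugacy in the wreath product *)

Section Sufficiency.
Variables (A B : groupType).
Variables (PA : recursive_presentation A) (PB : recursive_presentation B).
Hypotheses (conjA : solvable_conjugacy_problem PA)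
  (conjB : solvable_conjugacy_problem PB) (powerB : solvable_power_problem PB).
Local Open Scope group_scope.
Local Notation evalA := (raw_eval (@gens _ PA)).
Local Notation evalB := (raw_eval (@gens _ PB)).
Local Notation raw := (seq nat).
(* A list of pairs of words over [B] and [A] encodes an element of A^(B). *)
Local Notation raw_fun := (seq (seq nat * seq nat)).
Implicit Types (c s t u : raw) (L M : raw_fun).

Let cA := computable_conj_of conjA.
Let cB := computable_conj_of conjB.

Definition eval_fun L : seq (B * A) := [seq (evalB q.1, evalA q.2) | q <- L].

Definition raw_same_coset c s t : bool :=
  `[< same_coset (evalB c) (evalB s) (evalB t) >].

Lemma computable_same_coset {X : Type} {cX : coded X} (c s t : X -> raw) :
  computable c -> computable s -> computable t ->
  computable (fun x => raw_same_coset (c x) (s x) (t x) : nat).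
Proof.
move=> cc cs ct; have ctV := computable_comp computable_raw_inv ct.
have cts : computable (fun x => raw_inv (t x) ++ s x) by computability.
have h := computable_comp (computable_decidable2 powerB) (computable_pair cc cts).
apply: computable_ext h => x; congr nat_of_bool; apply/asbool_equiv_eq.
rewrite !word_eval_of_raw raw_eval_cat raw_eval_inv -same_coset1.
rewrite -(same_coset_mull _ (evalB (t x))) mulVKg mulg1.
by [].
Qed.

Definition raw_exp c n : raw := iteri n (fun _ z => z ++ c) [::].

Lemma raw_eval_exp c n : evalB (raw_exp c n) = evalB c ^+ n.
Proof.
elim: n => [|n IH]; first by rewrite raw_eval_nil.
by rewrite /= raw_eval_cat IH expgSr.
Qed.

Lemma computable_raw_exp {X : Type} {cX : coded X} (c : X -> raw) (n : X -> nat) :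
  computable c -> computable n -> computable (fun x => raw_exp (c x) (n x)).
Proof.
move=> cc cn; rewrite /raw_exp.
apply: (computable_iteri (step := fun x _ z => z ++ c x)) => //; computability.
Qed.

Definition raw_value L s : raw :=
  flatten [seq q.2 | q <- [seq q <- L | evalB q.1 == evalB s]].

Lemma evalA_flatten L (p : pred (raw * raw)) :
  evalA (flatten [seq q.2 | q <- [seq q <- L | p q]]) =
  \prod_(q <- L | p q) evalA q.2.
Proof.
elim: L => [|q L IH]; first by rewrite big_nil raw_eval_nil.
by rewrite big_cons -IH /=; case: (p q) => //; rewrite raw_eval_cat.
Qed.

Lemma raw_valueE L s : evalA (raw_value L s) = list_fun (eval_fun L) (evalB s).
Proof. by rewrite /raw_value evalA_flatten /list_fun big_map. Qed.

Lemma computable_raw_value {X : Type} {cX : coded X} (L : X -> raw_fun)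
    (s : X -> raw) :
  computable L -> computable s -> computable (fun x => raw_value (L x) (s x)).
Proof.
move=> cL cs; rewrite /raw_value; computability.
by apply: (computable_raw_eq cB); computability.
Qed.

Definition raw_coset_prod L r c n : raw :=
  iteri n (fun k z => z ++ raw_value L (r ++ raw_exp c k)) [::].

Lemma raw_coset_prodE L r c n :
  evalA (raw_coset_prod L r c n) =
  coset_prod (list_fun (eval_fun L)) (evalB r) (evalB c) n.
Proof.
elim: n => [|n IH]; first by rewrite raw_eval_nil.
by rewrite coset_prodS -IH /= raw_eval_cat raw_valueE raw_eval_cat raw_eval_exp.
Qed.

Lemma computable_raw_coset_prod {X : Type} {cX : coded X} (L : X -> raw_fun)
    (r c : X -> raw) (n : X -> nat) :
  computable L -> computable r -> computable c -> computable n ->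
  computable (fun x => raw_coset_prod (L x) (r x) (c x) (n x)).
Proof.
move=> cL cr cc cn; rewrite /raw_coset_prod.
apply: (computable_iteri (step := fun x k z =>
  z ++ raw_value (L x) (r x ++ raw_exp (c x) k))) => //; last computability.
computability.
apply: computable_raw_value; computability.
by apply: computable_raw_exp; computability.
Qed.

Definition raw_points L M : seq raw := [seq q.1 | q <- L ++ M].

Definition raw_cohomologous c L M : bool :=
  `[< cohomologous (evalB c) (list_fun (eval_fun L)) (list_fun (eval_fun M)) >].

Lemma map_fst_eval L : map fst (eval_fun L) = [seq evalB q.1 | q <- L].
Proof. by rewrite -map_comp. Qed.

(** The abelian case and the case with an order problem share this reduction and differ only in the
    test [P] run at each listed point. *)
Lemma raw_cohomologousP c L M (P : raw -> bool) :
  (forall t, t \in raw_points L M ->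
    P t <-> cohomologous_at (evalB c) (evalB t) (list_fun (eval_fun L))
              (list_fun (eval_fun M))) ->
  raw_cohomologous c L M = all P (raw_points L M).
Proof.
have supp (s : B) : list_fun (eval_fun L) s <> 1 \/ list_fun (eval_fun M) s <> 1 ->
    exists2 t, t \in map evalB (raw_points L M) & same_coset (evalB c) s t.
  move=> LMs; exists s; last exact: same_coset_refl.
  rewrite -map_comp map_cat mem_cat; case: LMs => /list_fun_supp;
  by rewrite map_fst_eval => ->; rewrite ?orbT.
move=> PP; rewrite /raw_cohomologous (propext (cohomologousP supp)).
apply/asboolP/allP => [h t tT|h _ /mapP[t tT ->]]; last exact/PP/h.
by apply/PP => //; apply: h; exact: map_f.
Qed.

Definition computable_cohomology : Prop :=
  computable (fun x : raw * (raw_fun * raw_fun) =>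
    raw_cohomologous x.1 x.2.1 x.2.2 : nat).

Lemma computable_cohomology_abelian : is_abelian A -> computable_cohomology.
Proof.
move=> abA.
pose prod c t L := flatten [seq q.2 | q <- [seq q <- L | raw_same_coset c q.1 t]].
have prodE c t L :
    evalA (prod c t L) = coset_list_prod (evalB c) (evalB t) (eval_fun L).
  by rewrite /prod evalA_flatten /coset_list_prod big_map.
apply: (@computable_ext _ _ _ _ (fun x : raw * (raw_fun * raw_fun) =>
    all (fun t => evalA (prod x.1 t x.2.1) == evalA (prod x.1 t x.2.2))
      (raw_points x.2.1 x.2.2) : nat)) => [x|].
  congr nat_of_bool; apply/esym/raw_cohomologousP => t _; rewrite !prodE.
  by rewrite (cohomologous_at_abelian abA); split=> /eqP.
rewrite /raw_points; computability; apply: (computable_raw_eq cA);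
  rewrite /prod; computability; by apply: computable_same_coset; computability.
Qed.

Definition raw_coset_bound c (T : seq raw) k : bool :=
  all (fun s => all (fun t => ~~ raw_same_coset c s t ||
    has (fun i => has (fun j =>
        evalB (s ++ raw_exp c i) == evalB (t ++ raw_exp c j))
      (iota 0 k.+1)) (iota 0 k.+1)) T) T.

Lemma raw_coset_boundP c T k :
  raw_coset_bound c T k <-> coset_bound (evalB c) k (map evalB T).
Proof.
split=> [/allP bd _ _ /mapP[s sT ->] /mapP[t tT ->] st|bd].
  have /allP /(_ _ tT)/orP[|] := bd _ sT; first by rewrite /raw_same_coset asboolT.
  case/hasP=> i; rewrite mem_iota => ik /hasP[j]; rewrite mem_iota => jk /eqP.
  by rewrite !raw_eval_cat !raw_eval_exp => e; exists i, j.
apply/allP => s sT; apply/allP => t tT.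
rewrite /raw_same_coset; case: asboolP => // st; rewrite orFb.
have [i [j [ik jk e]]] := bd _ _ (map_f _ sT) (map_f _ tT) st.
apply/hasP; exists i; first by rewrite mem_iota.
apply/hasP; exists j; first by rewrite mem_iota.
by rewrite !raw_eval_cat !raw_eval_exp e.
Qed.

(** The power problem only says that exponents exist; the search supplies a bound for them. *)
Lemma computable_bound : exists2 N : raw * (raw_fun * raw_fun) -> nat,
  computable N & forall x,
    coset_bound (evalB x.1) (N x) (map evalB (raw_points x.2.1 x.2.2)).
Proof.
have [x||N cN NP] := @computable_search (raw * (raw_fun * raw_fun)) _
    (fun x => raw_coset_bound x.1 (raw_points x.2.1 x.2.2)).
- have [k bd] := coset_bound_ex (evalB x.1) (map evalB (raw_points x.2.1 x.2.2)).
  by exists k; apply/raw_coset_boundP.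
- rewrite /raw_coset_bound /raw_points; computability.
    by apply: computable_same_coset; computability.
  by apply: (computable_raw_eq cB); computability;
    apply: computable_raw_exp; computability.
by exists N => // x; apply/raw_coset_boundP.
Qed.

Hypothesis orderB : solvable_order_problem PB.

Definition raw_finite c : bool := `[< finite_order (evalB c) >].

Lemma computable_raw_finite : computable (fun c => raw_finite c : nat).
Proof.
apply: computable_ext (computable_decidable1 orderB) => c.
by rewrite word_eval_of_raw.
Qed.

Lemma computable_order : exists2 n : raw -> nat, computable n &
  forall c, finite_order (evalB c) -> [/\ (0 < n c)%N, evalB c ^+ n c = 1 &
    forall k, (0 < k < n c)%N -> evalB c ^+ k <> 1].
Proof.
(* The first disjunct stops the search at once when the order is infinite, so that it succeeds on
   every input. *)
pose p c k := ~~ raw_finite c || [&& (0 < k)%N, evalB (raw_exp c k) == evalB [::] &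
  all (fun j => (j == 0) || ~~ (evalB (raw_exp c j) == evalB [::])) (iota 0 k)].
have [c||n cn nP] := @computable_search raw _ p.
- rewrite /p /raw_finite; case: asboolP => [/finite_order_min[n [n0 cn cmin]]|_].
    exists n; rewrite n0 raw_eval_exp raw_eval_nil cn eqxx /=; apply/allP => k.
    rewrite mem_iota raw_eval_exp => /= kn.
    by case: k kn => //= k kn; apply/eqP/cmin.
  by exists 0.
- have cf := computable_raw_finite; rewrite /p; computability.
  + by apply: (computable_comp cf); computability.
  + by apply: (computable_raw_eq cB); computability;
      apply: computable_raw_exp; computability.
  + by apply: (computable_raw_eq cB); computability;
      apply: computable_raw_exp; computability.
exists n => // c fin; have := nP c; rewrite /p /raw_finite asboolT //=.
case/and3P=> n0 /eqP; rewrite raw_eval_exp raw_eval_nil => cn1 /allP cmin.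
split=> // k /andP[k0 kn]; have := cmin k; rewrite mem_iota kn => /(_ isT).
rewrite raw_eval_exp => /orP[/eqP k00|/eqP//].
by move: k0; rewrite k00.
Qed.

Lemma computable_cohomology_order : computable_cohomology.
Proof.
have [n cn nP] := computable_order; have [N cN NP] := computable_bound.
(* The start of the window from [coset_bound_window]. Its length 2N + 1 is written below with a sum,
   the form that [computable_addn] handles. *)
pose base x t : raw := t ++ raw_inv (raw_exp x.1 (N x)).
pose fin x t : bool := `[< exists z,
  evalA (raw_coset_prod x.2.2 t x.1 (n x.1)) =
  evalA (raw_coset_prod x.2.1 t x.1 (n x.1)) ^ z >].
pose inf x t : bool :=
  evalA (raw_coset_prod x.2.1 (base x t) x.1 (N x + N x).+1) ==
  evalA (raw_coset_prod x.2.2 (base x t) x.1 (N x + N x).+1).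
apply: (@computable_ext _ _ _ _ (fun x : raw * (raw_fun * raw_fun) =>
    if raw_finite x.1 then all (fin x) (raw_points x.2.1 x.2.2) : nat
    else all (inf x) (raw_points x.2.1 x.2.2) : nat)) => [x|].
  rewrite /raw_finite; case: asboolP => [fi|ni].
    have [n0 cn1 cmin] := nP _ fi.
    congr nat_of_bool; apply/esym/raw_cohomologousP => t _.
    rewrite (cohomologous_at_finite _ _ _ n0 cn1 cmin) -!raw_coset_prodE.
    by split=> /asboolP.
  congr nat_of_bool; apply/esym/raw_cohomologousP => t tT.
  have sub L : {subset [seq q.1 | q <- L] <= raw_points x.2.1 x.2.2} ->
      {subset map fst (eval_fun L) <= map evalB (raw_points x.2.1 x.2.2)}.
    move=> LT s; rewrite map_fst_eval => /mapP[q qL ->].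
    by apply/map_f/LT/map_f.
  have win L : {subset [seq q.1 | q <- L] <= raw_points x.2.1 x.2.2} ->
      in_window (evalB x.1) (evalB (base x t)) (N x + N x).+1
        (list_fun (eval_fun L)).
    move=> LT; rewrite /base raw_eval_cat raw_eval_inv raw_eval_exp addnn.
    exact: in_window_list (NP x) (map_f _ tT) (sub _ LT).
  have bt : same_coset (evalB x.1) (evalB (base x t)) (evalB t).
    rewrite /base raw_eval_cat raw_eval_inv raw_eval_exp.
    exact: same_coset_mulVX.
  have winL : in_window (evalB x.1) (evalB (base x t)) (N x + N x).+1
      (list_fun (eval_fun x.2.1)).
    by apply: win => s sL; rewrite /raw_points map_cat mem_cat sL.
  have winM : in_window (evalB x.1) (evalB (base x t)) (N x + N x).+1
      (list_fun (eval_fun x.2.2)).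
    by apply: win => s sL; rewrite /raw_points map_cat mem_cat sL orbT.
  have := cohomologous_at_infinite ni winL winM; rewrite -!raw_coset_prodE => e.
  split=> [/eqP/e|h]; first exact: cohomologous_at_coset.
  by apply/eqP/e; exact: cohomologous_at_coset (same_coset_sym bt) h.
have cf := computable_raw_finite; rewrite /raw_points; computability.
- by apply: (computable_comp cf); computability.
- have c1 : computable (fun p : raw * (raw_fun * raw_fun) * raw =>
      raw_coset_prod p.1.2.1 p.2 p.1.1 (n p.1.1)).
    by apply: computable_raw_coset_prod; computability.
  have c2 : computable (fun p : raw * (raw_fun * raw_fun) * raw =>
      raw_coset_prod p.1.2.2 p.2 p.1.1 (n p.1.1)).
    by apply: computable_raw_coset_prod; computability.
  exact: computable_comp cA (computable_pair c1 c2).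
have cb : computable (fun p : raw * (raw_fun * raw_fun) * raw => base p.1 p.2).
  rewrite /base; computability; apply: (computable_comp computable_raw_inv).
  by apply: computable_raw_exp; computability.
apply: (computable_raw_eq cA); apply: computable_raw_coset_prod; computability;
  by apply: computable_addn; computability.
Qed.

End Sufficiency.

(** * Generators, normal forms and the conjugacy test for the wreath product *)

Section WreathPresentation.
Variables (A B : groupType).
Variables (PA : recursive_presentation A) (PB : recursive_presentation B).
Local Open Scope group_scope.
Local Notation mA := (generator_count PA).
Local Notation mB := (generator_count PB).
Local Notation evalA := (raw_eval (@gens _ PA)).
Local Notation evalB := (raw_eval (@gens _ PB)).
Local Notation raw := (seq nat).
Local Notation raw_fun := (seq (seq nat * seq nat)).
Local Notation W := (wreath A B).
Implicit Types (s : raw).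

Definition wreath_gens (i : 'I_(mB + mA)) : W :=
  match split i with
  | inl j => base_elt A (gens j)
  | inr j => point_elt B (gens j)
  end.

Local Notation evalW := (raw_eval wreath_gens).

Lemma letter_eval_base k : (k < mB.*2)%N ->
  letter_eval wreath_gens k = base_elt A (letter_eval (@gens _ PB) k).
Proof.
rewrite -ltn_half_double /letter_eval /wreath_gens => kB.
case: insubP => [i _ ei|]; last by rewrite ltn_addr.
case: insubP => [j _ ej|]; last by rewrite kB.
case: splitP => l el; have {ei el} := etrans (esym ei) el; last first.
  by move=> kl; move: kB; rewrite kl ltnNge leq_addr.
rewrite -ej => /val_inj ->.
by case: odd; rewrite ?base_eltV.
Qed.

Lemma letter_eval_point k : letter_eval wreath_gens (mB.*2 + k)%N =
  point_elt B (letter_eval (@gens _ PA) k).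
Proof.
rewrite /letter_eval /wreath_gens halfD oddD odd_double doubleK /= add0n.
case: (insubP 'I_mA) => [j _ ej|]; last first.
  rewrite -leqNgt => kA; rewrite insubF ?point_elt1 //.
  by rewrite ltnNge leq_add2l kA.
case: insubP => [i _ ei|]; last by rewrite ltn_add2l -ej ltn_ord.
case: splitP => l el; have {ei el} := etrans (esym ei) el.
  by move=> kl; have := ltn_ord l; rewrite -kl ltnNge leq_addr.
rewrite -ej => /addnI/val_inj <-.
by case: odd; rewrite ?point_eltV.
Qed.

(* Letter codes below [mB.*2] are those of [B]. Moving a letter of [A] past the
   base part [z.1] on its right places it at the point [z.1]. *)
Definition normal_form s : raw * raw_fun :=
  foldr (fun k z => if (k < mB.*2)%N then (k :: z.1, z.2)
                    else (z.1, (z.1, [:: (k - mB.*2)%N]) :: z.2)) ([::], [::]) s.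

Lemma computable_normal_form : computable normal_form.
Proof.
apply: (computable_foldr (step := fun _ k z => if (k < mB.*2)%N
  then (k :: z.1, z.2) else (z.1, (z.1, [:: (k - mB.*2)%N]) :: z.2)));
  computability.
Qed.

Lemma normal_formE s :
  wreath_base (evalW s) = evalB (normal_form s).1 /\
  wreath_fun (evalW s) =1 list_fun (eval_fun PA PB (normal_form s).2).
Proof.
elim: s => [|k s [IHb IHf]].
  rewrite !raw_eval_nil; split=> // x.
  by rewrite wreath_fun1 /list_fun big_nil.
rewrite raw_eval_cons /=; case: ltnP => kB.
  rewrite letter_eval_base //= raw_eval_cons IHb; split=> // x.
  by rewrite fun_mulE fun_actE fsfun0E mul1g IHf.
have := letter_eval_point (k - mB.*2); rewrite subnKC // => ->.
split=> [|x]; first by rewrite /= mul1g.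
rewrite wreath_funM point_eltE IHf list_fun_cons /= IHb.
by rewrite raw_eval_cons raw_eval_nil mulg1 divg_eq mul1g eq_sym.
Qed.

Lemma evalW_base s : exists u, evalW u = base_elt A (evalB s).
Proof.
exists [seq k <- s | (k < mB.*2)%N]; elim: s => [|k s IH] /=.
  by rewrite !raw_eval_nil base_elt1.
rewrite raw_eval_cons base_eltM -IH; case: ltnP => kB.
  by rewrite raw_eval_cons letter_eval_base.
by rewrite letter_eval_default // base_elt1 mul1g.
Qed.

Lemma evalW_point s : exists u, evalW u = point_elt B (evalA s).
Proof.
exists [seq (mB.*2 + k)%N | k <- s]; elim: s => [|k s IH] /=.
  by rewrite !raw_eval_nil point_elt1.
by rewrite !raw_eval_cons point_eltM -IH letter_eval_point.
Qed.

Lemma list_fun_graph (f : {fsfun B -> A with 1}) :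
  list_fun [seq (t, f t) | t <- finsupp f] =1 f.
Proof.
move=> s; rewrite /list_fun big_map /=.
have [sf|sf] := boolP (s \in finsupp f); last first.
  rewrite (fsfun_dflt sf) big_seq_cond big_pred0 // => t.
  by case: eqP => [->|]; rewrite ?(negPf sf) ?andbF.
by rewrite -big_filter filter_pred1_uniq ?fset_uniq // big_seq1.
Qed.

Lemma wreath_gens_generate x : exists w, word_eval wreath_gens w = x.
Proof.
suff [s <-] : exists s, evalW s = x.
  by exists (word_of_raw _ s); rewrite word_eval_of_raw.
have surjA a : exists s, evalA s = a := raw_eval_surj (@gens_generate _ PA) a.
have surjB b : exists s, evalB s = b := raw_eval_surj (@gens_generate _ PB) b.
(* The function part is assembled over the trivial base, one conjugate of a point element for each
   pair in its graph. The base part is then put on the left, where it does not move the function. *)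
have [s fs] : exists s, wreath_base (evalW s) = 1 /\
    wreath_fun (evalW s) =1
    list_fun [seq (t, wreath_fun x t) | t <- finsupp (wreath_fun x)].
  elim: [seq _ | t <- _] => [|[t a] L [s [bs fs]]].
    exists [::]; rewrite raw_eval_nil; split=> // t.
    by rewrite wreath_fun1 /list_fun big_nil.
  have [sa <-] := surjA a; have [u ua] := evalW_point sa.
  have [st <-] := surjB t; have [v vt] := evalW_base st.
  exists (raw_inv v ++ u ++ v ++ s).
  rewrite !raw_eval_cat raw_eval_inv ua vt !mulgA -[_ * _ * base_elt _ _]mulgA.
  rewrite -conjgE; split=> [|r].
    by rewrite wreath_baseM point_conj_base mul1g.
  rewrite wreath_funM point_conjE bs invg1 mulg1 fs list_fun_cons /=.
  by rewrite eq_sym.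
have [sb eb] := surjB (wreath_base x); have [u eu] := evalW_base sb.
exists (u ++ s); rewrite raw_eval_cat eu eb; apply: wreathP => [|r].
  by rewrite wreath_baseM fs.1 mulg1.
by rewrite wreath_funM base_eltE mul1g fs.2 list_fun_graph.
Qed.

Hypotheses (conjB : solvable_conjugacy_problem PB)
  (cohAB : computable_cohomology PA PB).

Let cB := computable_conj_of conjB.

Definition shift_fun (L : raw_fun) (d : raw) : raw_fun :=
  [seq (q.1 ++ d, q.2) | q <- L].

Lemma shift_funE L d u : list_fun (eval_fun PA PB (shift_fun L d)) u =
  list_fun (eval_fun PA PB L) (u * (evalB d)^-1).
Proof.
rewrite /list_fun /eval_fun !big_map; apply: eq_bigl => q /=.
by rewrite raw_eval_cat eq_sym -divg_eq eq_sym.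
Qed.

(** [wreath_conjP] as a finite test: the candidates for d are the words t^-1 s with t and s listed
    points. In the second alternative the existence of d is a conjugacy question in [B], and the
    empty list stands for the constant function 1. *)
Definition raw_wreath_conj (p : raw * raw) : bool :=
  let x := normal_form p.1 in let y := normal_form p.2 in
  has (fun q => has (fun r =>
      (evalB (x.1 ++ raw_inv q.1 ++ r.1) == evalB ((raw_inv q.1 ++ r.1) ++ y.1)) &&
      raw_cohomologous PA PB y.1 (shift_fun x.2 (raw_inv q.1 ++ r.1)) y.2) y.2) x.2
  || [&& `[< exists z, evalB y.1 = evalB x.1 ^ z >],
         raw_cohomologous PA PB x.1 x.2 [::] &
         raw_cohomologous PA PB y.1 [::] y.2].

Lemma raw_wreath_conjP p : raw_wreath_conj p <->
  exists z, evalW p.2 = evalW p.1 ^ z.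
Proof.
have [bx fx] := normal_formE p.1; have [ey fy] := normal_formE p.2.
move: bx fx ey fy; rewrite /raw_wreath_conj.
move: (normal_form p.1) (normal_form p.2) => [b L] [c M] /= bx fx ey fy.
have suppx (s : B) :
    wreath_fun (evalW p.1) s <> 1 -> s \in map fst (eval_fun PA PB L).
  by rewrite fx => /list_fun_supp.
have suppy (s : B) :
    wreath_fun (evalW p.2) s <> 1 -> s \in map fst (eval_fun PA PB M).
  by rewrite fy => /list_fun_supp.
rewrite (wreath_conjP suppx suppy) bx ey !map_fst_eval.
have f1 : (fun=> 1 : A) = list_fun (eval_fun PA PB [::]).
  by apply: funext => u; rewrite /list_fun big_nil.
rewrite (funext fx) (funext fy) f1.
have eshift t s : (fun u => list_fun (eval_fun PA PB L)
    (u * ((evalB t)^-1 * evalB s)^-1)) =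
    list_fun (eval_fun PA PB (shift_fun L (raw_inv t ++ s))).
  by apply: funext => u; rewrite shift_funE raw_eval_cat raw_eval_inv.
split=> [/orP[]|[]].
- case/hasP=> q qL /hasP[r rM] /andP[/eqP e /asboolP coh]; left.
  exists (evalB q.1); first exact: map_f.
  exists (evalB r.1); first exact: map_f.
  by move: e; rewrite eshift !raw_eval_cat raw_eval_inv.
- case/and3P=> /asboolP[z ez] /asboolP cL /asboolP cM; right; split=> //.
  by exists z; rewrite ez conjgE mulVKg.
- case=> _ /mapP[q qL ->] [_ /mapP[r rM ->]]; rewrite eshift => -[e coh].
  apply/orP; left; apply/hasP; exists q => //; apply/hasP; exists r => //.
  by rewrite !raw_eval_cat raw_eval_inv e eqxx; apply/asboolP.
case=> -[d ed] cL cM; apply/orP; right; apply/and3P; split; apply/asboolP => //.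
by exists d; rewrite conjgE ed mulKg.
Qed.

Lemma computable_wreath_conj : computable_conj wreath_gens.
Proof.
apply: (@computable_ext _ _ _ _ (fun p => raw_wreath_conj p : nat)) => [p|].
  by congr nat_of_bool; apply/idP/asboolP => /raw_wreath_conjP.
have cn := computable_normal_form.
have coh (X : Type) (cX : coded X) (c : X -> raw) (L M : X -> raw_fun) :
    computable c -> computable L -> computable M ->
    computable (fun x => raw_cohomologous PA PB (c x) (L x) (M x) : nat).
  move=> cc cL cM.
  exact: computable_comp cohAB (computable_pair cc (computable_pair cL cM)).
rewrite /raw_wreath_conj; computability.
- have ci := computable_raw_inv; apply: (computable_raw_eq cB); computability.
- have ci := computable_raw_inv; apply: coh; rewrite /shift_fun; computability.
- have c1 : computable (fun p : raw * raw => (normal_form p.1).1) by computability.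
  have c2 : computable (fun p : raw * raw => (normal_form p.2).1) by computability.
  exact: computable_comp cB (computable_pair c1 c2).
- by apply: coh; computability.
by apply: coh; computability.
Qed.

End WreathPresentation.

Theorem theorem1p0p1 (A B : groupType)
    (ntA : nontrivial A) (ntB : nontrivial B)
    (PA : recursive_presentation A) (PB : recursive_presentation B)
    (conjA : solvable_conjugacy_problem PA)
    (conjB : solvable_conjugacy_problem PB) :
  class_C (wreath A B) <->
    (solvable_power_problem PB /\
     (is_abelian A \/ solvable_order_problem PB)).
Proof.
split=> [cW|[powB ab_or]].
  split; first exact: power_problem_of_wreath ntA cW.
  have [abA|nabA] := pselect (is_abelian A); [by left|right].
  exact: order_problem_of_wreath nabA.
apply: (@class_C_of_conj _ _ (@wreath_gens A B PA PB)).
  apply: computable_wreath_conj => //.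
  case: ab_or => [abA|ordB].
    exact: computable_cohomology_abelian.
  exact: computable_cohomology_order.
exact: wreath_gens_generate.
Qed.
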